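(* Let $WB_3$ be the welded braid group on $3$ strands, let $\mathrm{w}TYM_3\colon WB_3\to GL_3(\mathbb{Z}[t^{\pm1},a^{\pm1}])$ be the Tong-Yang-Ma representation of $WB_3$, and let $\alpha\colon WB_3\to\mathbb{Z}\cong\langle z\rangle$ be the surjective homomorphism with $\alpha(\sigma_i)=z$ and $\alpha(\tau_i)=1$ for $i=1,2$ (here $1=z^0$ is the identity of $\langle z\rangle$). Then the twisted Alexander invariant of $WB_3$ associated with $\mathrm{w}TYM_3$ (and $\alpha$) is $$\Delta_{WB_3,\mathrm{w}TYM_3}(z)=1$$ up to a factor $\varepsilon z^c$ with $\varepsilon\in(\mathbb{Z}[t^{\pm1},a^{\pm1}])^\times$ and $c\in\mathbb{Z}$.
   Context: Welded braid group: $WB_n$ is the group with generators $\sigma_i,\tau_i$ ($1\le i\le n-1$) and relations $\sigma_i\sigma_j=\sigma_j\sigma_i$, $\tau_i\tau_j=\tau_j\tau_i$, $\sigma_i\tau_j=\tau_j\sigma_i$ for $|i-j|\ge2$; $\tau_i^2=1$ for $1\le i\le n-1$; and $\sigma_i\sigma_{i+1}\sigma_i=\sigma_{i+1}\sigma_i\sigma_{i+1}$, $\tau_i\tau_{i+1}\tau_i=\tau_{i+1}\tau_i\tau_{i+1}$, $\sigma_i\tau_{i+1}\tau_i=\tau_{i+1}\tau_i\sigma_{i+1}$, $\tau_i\sigma_{i+1}\sigma_i=\sigma_{i+1}\sigma_i\tau_{i+1}$ for $1\le i\le n-2$. Tong-Yang-Ma representation of $WB_n$: the homomorphism $\mathrm{w}TYM_n\colon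 WB_n\to GL_n(\mathbb{Z}[t^{\pm1},a^{\pm1}])$ given by $\sigma_i\mapsto I_{i-1}\oplus\begin{pmatrix}0&1\\ t&0\end{pmatrix}\oplus I_{n-i-1}$ and $\tau_i\mapsto I_{i-1}\oplus\begin{pmatrix}0&a^{-1}\\ a&0\end{pmatrix}\oplus I_{n-i-1}$, where $I_k$ is the $k\times k$ identity matrix. Twisted Alexander invariant (Wada): Let $G=\langle x_1,\dots,x_l\mid r_1,\dots,r_m\rangle$ be a finitely presented group, $\alpha\colon G\to\mathbb{Z}\cong\langle z\rangle$ a surjective homomorphism, $R$ a unique factorization domain, and $\rho\colon G\to GL_N(R)$ a representation. Let $F_l$ be the free group on $x_1,\dots,x_l$, and let $\Phi\colon\mathbb{Z}[F_l]\to M_N(R[z^{\pm1}])$ be the ring homomorphism obtained by composing the linear extension of the projection $F_l\to G$ with the linear extension of $g\mapsto\rho(g)\alpha(g)$. For each $j$, the Fox derivation $\frac{\partial}{\partial x_j}\colon\mathbb{Z}[F_l]\to\mathbb{Z}[F_l]$ is the $\mathbb{Z}$-linear map with $\frac{\partial x_i}{\partial x_j}=\delta_{ij}$ and $\frac{\partial(gg')}{\partial x_j}=\frac{\partial g}{\partial x_j}+g\frac{\partial g'}{\partial x_j}$ for $g,g'\in F_l$. Let $M$ be the $m\times l$ block matrix whose $(i,j)$ block is the $N\times N$ matrix $\Phi\left(\frac{\partial r_i}{\partial x_j}\right)$. Let $M_j$ be the matrix obtained from $M$ by removing the $j$-th block column, regarded as an $mN\times(l-1)N$ matrix over $R[z^{\pm1}]$.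 For $I=(i_1<\dots<i_{(l-1)N})$ with $1\le i_k\le mN$, let $M_j^I$ be the square submatrix of $M_j$ consisting of the rows $i_1,\dots,i_{(l-1)N}$. There is always some $j$ with $\det\Phi(1-x_j)\neq0$, and for such $j$ one defines $$\Delta_{G,\rho}(z):=\frac{\gcd_I(\det M_j^I)}{\det\Phi(1-x_j)},$$ the gcd being taken in $R[z^{\pm1}]$ over all choices of $I$ (if $m<l-1$, one sets $\Delta_{G,\rho}(z):=0$). It is well defined up to a factor $\varepsilon z^c$ ($\varepsilon\in R^\times$, $c\in\mathbb{Z}$), independently of the choice of $j$ and of the presentation of $G$; equalities of twisted Alexander invariants are understood up to such factors. *)

(* Defs.v *)
From HB Require Import structures.
From mathcomp Require Import all_boot all_order all_algebra.
From mathcomp Require Import generic_quotient fraction finmap boolp.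
From mathcomp Require Import monalg zify.

Set Implicit Arguments.
Unset Strict Implicit.
Unset Printing Implicit Defensive.

Import Order.TTheory GRing.Theory Num.Theory.

Local Open Scope ring_scope.

(* Free group on X, as the set of reduced words; the letter (x, b) stands for *)
(* x if b = false and for x^-1 if b = true.                                   *)
Section FreeGroup.

Variable X : choiceType.

Local Notation letter := (X * bool)%type.

Implicit Types (a : letter) (u v w : seq letter).

Definition linv a : letter := (a.1, ~~ a.2).

Definition reduced w : bool := sorted (fun a b => b != linv a) w.

Record freegroup := FreeWord { fword : seq letter; fword_reduced : reduced fword }.
HB.instance Definition _ := [isSub for fword].
HB.instance Definition _ := [Choice of freegroup by <:].

Definition push a w : seq letter :=
  if w is b :: w' then if b == linv a then w' else a :: w else [:: a].

Lemma linvK : involutive linv.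
Proof. by case=> x b; rewrite /linv /= negbK. Qed.

Lemma reduced_cons a w : reduced (a :: w) -> reduced w.
Proof. by case: w => [|b w] //= /andP[]. Qed.

Lemma reduced_push a w : reduced w -> reduced (push a w).
Proof.
case: w => [|b w] //= red_bw; case: eqP => [_|/eqP neq_ba]; last first.
  by apply/andP.
exact: reduced_cons red_bw.
Qed.

Lemma reduced_foldr u v : reduced v -> reduced (foldr push v u).
Proof. by move=> red_v; elim: u => //= a u; apply: reduced_push. Qed.

Lemma push_reduced a w : reduced (a :: w) -> push a w = a :: w.
Proof. by case: w => [|b w] //= /andP[/negbTE->]. Qed.

Lemma pushK a w : reduced w -> push a (push (linv a) w) = w.
Proof.
case: w => [|b w]; first by rewrite /= eqxx.
move=> red_bw /=; rewrite linvK; case: eqP => [eq_ba|_]; last by rewrite /= eqxx.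
by rewrite -eq_ba push_reduced.
Qed.

Lemma foldr_push a v w : reduced v -> reduced w ->
  foldr push w (push a v) = push a (foldr push w v).
Proof.
case: v => [|b v] //= red_bv red_w; case: eqP => [->|_] //.
by rewrite pushK ?reduced_foldr.
Qed.

Lemma foldr_pushA u v w : reduced v -> reduced w ->
  foldr push w (foldr push v u) = foldr push (foldr push w v) u.
Proof.
move=> red_v red_w; elim: u => //= a u IHu.
by rewrite foldr_push ?reduced_foldr // IHu.
Qed.

Lemma foldr_push_id u : reduced u -> foldr push [::] u = u.
Proof.
elim: u => //= a u IHu red_au; rewrite IHu ?push_reduced //.
exact: reduced_cons red_au.
Qed.

Definition fg_one : freegroup := @FreeWord [::] isT.

Definition fg_mul (g h : freegroup) : freegroup :=
  FreeWord (reduced_foldr (fword g) (fword_reduced h)).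

Fact reduced_inv w : reduced w -> reduced (rev (map linv w)).
Proof.
rewrite /reduced rev_sorted sorted_map; apply: sub_sorted => a b /=.
by apply: contra => /eqP/(can_inj linvK)->; rewrite linvK.
Qed.

Definition fg_inv (g : freegroup) : freegroup :=
  FreeWord (reduced_inv (fword_reduced g)).

Fact fg_mulA : associative fg_mul.
Proof.
move=> g h k; apply: val_inj => /=.
by rewrite foldr_pushA ?fword_reduced.
Qed.

Fact fg_mul1 : left_id fg_one fg_mul.
Proof. by move=> g; apply: val_inj. Qed.

Fact fg_mulr1 : right_id fg_one fg_mul.
Proof. by move=> g; apply: val_inj; rewrite /= foldr_push_id ?fword_reduced. Qed.

Fact fg_mulV : left_inverse fg_one fg_inv fg_mul.
Proof.
case=> u red_u; apply: val_inj => /=; elim: u red_u => //= a u IHu red_au.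
rewrite rev_cons foldr_rcons /= linvK eqxx; apply: IHu.
exact: reduced_cons red_au.
Qed.

Fact fg_mulrV : right_inverse fg_one fg_inv fg_mul.
Proof.
have invK : involutive fg_inv.
  by move=> g; apply: val_inj; rewrite /= map_rev revK mapK //; apply: linvK.
by move=> g; rewrite -{1}[g]invK fg_mulV.
Qed.

HB.instance Definition _ :=
  isGroup.Build freegroup fg_mulA fg_mul1 fg_mulr1 fg_mulV fg_mulrV.

Definition fgen (x : X) : freegroup := @FreeWord [:: (x, false)] isT.

Section Eval.

Variables (H : groupType) (f : X -> H).

Definition leval a : H := (if a.2 then (f a.1)^-1 else f a.1)%g.

Definition fg_eval (g : freegroup) : H := (\prod_(a <- fword g) leval a)%g.

Lemma leval_inv a : leval (linv a) = ((leval a)^-1)%g.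
Proof. by case: a => x [] //=; rewrite /leval /= ?invgK. Qed.

Fact fg_eval1 : fg_eval 1%g = 1%g.
Proof. by rewrite /fg_eval big_nil. Qed.

Fact fg_evalM : {morph fg_eval : g h / (g * h)%g}.
Proof.
move=> g h; rewrite /fg_eval /=; elim: (fword g) => [|a u IHu] /=.
  by rewrite big_nil mul1g.
rewrite big_cons -mulgA -IHu; case: foldr => [|b w] /=.
  by rewrite big_seq1 big_nil mulg1.
case: eqP => [->|_]; last by rewrite big_cons.
by rewrite big_cons leval_inv mulVKg.
Qed.

HB.instance Definition _ :=
  monoid.isMultiplicative.Build freegroup H fg_eval fg_evalM.
HB.instance Definition _ :=
  Multiplicative_isUMagmaMorphism.Build freegroup H fg_eval fg_eval1.

Lemma fg_eval_gen x : fg_eval (fgen x) = f x.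
Proof. by rewrite /fg_eval big_seq1. Qed.

End Eval.

Lemma fg_eval_id (g : freegroup) : fg_eval fgen g = g.
Proof.
apply: val_inj; case: g => u red_u; rewrite /fg_eval /=.
elim: u red_u => [|a u IHu] red_au; first by rewrite big_nil.
rewrite big_cons /= IHu; last exact: reduced_cons red_au.
by case: a red_au => x [] red_au; rewrite /leval /= push_reduced.
Qed.

End FreeGroup.

Section PresentedGroup.

Record presentation := Presentation {
  ngens : nat;
  relators : seq (freegroup 'I_ngens) }.

Variable P : presentation.

Notation F := (freegroup 'I_(ngens P)).

(* ncl g: g lies in the normal closure of the relators in the free group. *)
Inductive ncl : F -> Prop :=
| ncl_rel r g of r \in relators P : ncl (r ^ g)%g
| ncl1 : ncl 1%g
| nclM g h of ncl g & ncl h : ncl (g * h)%g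
| nclV g of ncl g : ncl (g^-1)%g.

Lemma nclJ g h : ncl g -> ncl (g ^ h)%g.
Proof.
elim=> {g} [r g rP | | g1 g2 _ IH1 _ IH2 | g _ IH].
- by rewrite -conjgM; apply: ncl_rel.
- by rewrite conj1g; apply: ncl1.
- by rewrite conjMg; apply: nclM.
- by rewrite conjVg; apply: nclV.
Qed.

Definition pres_eq (g h : F) : bool := `[< ncl (g / h)%g >].

Fact pres_eq_refl : reflexive pres_eq.
Proof. by move=> g; apply/asboolP; rewrite divgg; apply: ncl1. Qed.

Fact pres_eq_sym : symmetric pres_eq.
Proof.
by move=> g h; apply/asboolP/asboolP => /nclV; rewrite invgF.
Qed.

Fact pres_eq_trans : transitive pres_eq.
Proof.
move=> h g k /asboolP gh /asboolP hk; apply/asboolP.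
by have := nclM gh hk; rewrite mulgA divgK.
Qed.

Canonical pres_eq_equiv :=
  EquivRel pres_eq pres_eq_refl pres_eq_sym pres_eq_trans.

Definition presgroup : Type := {eq_quot pres_eq}%qT.
HB.instance Definition _ := Choice.on presgroup.

Definition pres_proj (g : F) : presgroup := \pi_{eq_quot pres_eq}%qT g.

Definition pg_mul (x y : presgroup) : presgroup := pres_proj (repr x * repr y)%g.
Definition pg_inv (x : presgroup) : presgroup := pres_proj (repr x)^-1%g.

Lemma pres_projP g h : pres_proj g = pres_proj h <-> ncl (g / h)%g.
Proof. by split=> [/eqmodP/asboolP|gh]; last exact/eqmodP/asboolP. Qed.

Lemma pres_reprK x : pres_proj (repr x) = x.
Proof. exact: reprK. Qed.

Lemma pres_projM_def g h : pg_mul (pres_proj g) (pres_proj h) = pres_proj (g * h)%g.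
Proof.
apply/pres_projP; set g' := repr _; set h' := repr _.
have gg' : ncl (g' / g)%g by apply/pres_projP; exact: pres_reprK.
have hh' : ncl (h' / h)%g by apply/pres_projP; exact: pres_reprK.
have -> : (g' * h' / (g * h) = (h' / h) ^ g'^-1 * (g' / g))%g.
  by rewrite conjgE invgK invgM !mulgA mulgVK.
by apply: nclM => //; apply: nclJ.
Qed.

Lemma pres_projV_def g : pg_inv (pres_proj g) = pres_proj g^-1%g.
Proof.
apply/pres_projP; set g' := repr _.
have gg' : ncl (g' / g)%g by apply/pres_projP; exact: pres_reprK.
rewrite invgK; have -> : (g'^-1 * g = ((g' / g)^-1) ^ g)%g.
  by rewrite conjgE invgF !mulgA mulVg mul1g.
by apply/nclJ/nclV.
Qed.

Fact pg_mulA : associative pg_mul.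
Proof.
move=> x y z; rewrite -[x]pres_reprK -[y]pres_reprK -[z]pres_reprK.
by rewrite !pres_projM_def mulgA.
Qed.

Fact pg_mul1 : left_id (pres_proj 1%g) pg_mul.
Proof. by move=> x; rewrite -[x]pres_reprK pres_projM_def mul1g. Qed.

Fact pg_mulr1 : right_id (pres_proj 1%g) pg_mul.
Proof. by move=> x; rewrite -[x]pres_reprK pres_projM_def mulg1. Qed.

Fact pg_mulV : left_inverse (pres_proj 1%g) pg_inv pg_mul.
Proof.
by move=> x; rewrite -[x]pres_reprK pres_projV_def pres_projM_def mulVg.
Qed.

Fact pg_mulrV : right_inverse (pres_proj 1%g) pg_inv pg_mul.
Proof.
by move=> x; rewrite -[x]pres_reprK pres_projV_def pres_projM_def mulgV.
Qed.

HB.instance Definition _ :=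
  isGroup.Build presgroup pg_mulA pg_mul1 pg_mulr1 pg_mulV pg_mulrV.

Fact pres_projM : {morph pres_proj : g h / (g * h)%g}.
Proof. by move=> g h; rewrite -pres_projM_def. Qed.

HB.instance Definition _ :=
  monoid.isMultiplicative.Build F presgroup pres_proj pres_projM.
HB.instance Definition _ :=
  Multiplicative_isUMagmaMorphism.Build F presgroup pres_proj (erefl _).

Definition pgen (i : 'I_(ngens P)) : presgroup := pres_proj (fgen i).

Section Lift.

Variables (H : groupType) (f : 'I_(ngens P) -> H).
Hypothesis f_rel : forall r, r \in relators P -> fg_eval f r = 1%g.

Definition pres_lift of (forall r, r \in relators P -> fg_eval f r = 1%g) :=
  fun x : presgroup => fg_eval f (repr x).

Lemma fg_eval_ncl g : ncl g -> fg_eval f g = 1%g.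
Proof.
elim=> {g} [r g rP | | g h _ IHg _ IHh | g _ IHg].
- by rewrite gmulfJ /= (f_rel rP) conj1g.
- exact: gmulf1.
- by rewrite gmulfM /= IHg IHh mulg1.
- by rewrite gmulfV /= IHg invg1.
Qed.

Lemma pres_lift_proj g : pres_lift f_rel (pres_proj g) = fg_eval f g.
Proof.
rewrite /pres_lift; apply/divg1_eq; rewrite -gmulfF; apply: fg_eval_ncl.
by apply/pres_projP; exact: pres_reprK.
Qed.

Lemma pres_lift_gen i : pres_lift f_rel (pgen i) = f i.
Proof. by rewrite pres_lift_proj fg_eval_gen. Qed.

Fact pres_liftM : {morph pres_lift f_rel : x y / (x * y)%g}.
Proof.
move=> x y; rewrite -[x]pres_reprK -[y]pres_reprK -gmulfM !pres_lift_proj.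
exact: gmulfM.
Qed.

HB.instance Definition _ :=
  monoid.isMultiplicative.Build presgroup H (pres_lift f_rel) pres_liftM.

End Lift.

End PresentedGroup.

(* The library makes {malg R[K]} a ring only for monoids K without nontrivial *)
(* units; grpring carries the convolution product for a group.                *)
Definition grpring (R : nzRingType) (G : groupType) : Type := {malg R[G]}.

HB.lock Definition gmon (R : nzRingType) (G : groupType) (c : R) (g : G)
    : grpring R G :=
  << c *g g >>.

Arguments gmon.body {R G} c%_R g%_g.

HB.lock Definition gr_mul (R : nzRingType) (G : groupType) (x y : grpring R G)
    : grpring R G :=
  \sum_(g <- msupp x) \sum_(h <- msupp y)
    << mcoeff g x * mcoeff h y *g (g * h)%g >>.

Section GroupRingOps.

Variables (R : nzRingType) (G : groupType).

Local Notation gr_mul := (@gr_mul R G).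

Implicit Types (x y z : {malg R[G]}) (g h : G) (c d : R).

Local Notation gr_one := (@gmon R G 1 1%g).

Lemma gr_mulw (A B : {fset G}) x y :
  (msupp x `<=` A)%fset -> (msupp y `<=` B)%fset ->
  gr_mul x y =
    \sum_(g <- A) \sum_(h <- B) << mcoeff g x * mcoeff h y *g (g * h)%g >>.
Proof.
move=> xA yB; rewrite gr_mul.unlock (big_fset_incl _ xA) /=.
  apply: eq_bigr => g _; apply: big_fset_incl => // h _ /mcoeff_outdom->.
  by rewrite mulr0 monalgU0.
move=> g _ /mcoeff_outdom xg; apply: big1 => h _.
by rewrite xg mul0r monalgU0.
Qed.

Lemma gr_mulDl : left_distributive gr_mul +%R.
Proof.
move=> x y z.
rewrite (gr_mulw (msuppD_le x y) (fsubset_refl _)).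
rewrite (gr_mulw (fsubsetUl _ (msupp y)) (fsubset_refl _)).
rewrite (gr_mulw (fsubsetUr (msupp x) _) (fsubset_refl _)).
rewrite -big_split; apply: eq_bigr => g _.
rewrite -big_split; apply: eq_bigr => h _ /=.
by rewrite mcoeffD mulrDl monalgUD.
Qed.

Lemma gr_mulDr : right_distributive gr_mul +%R.
Proof.
move=> z x y.
rewrite (gr_mulw (fsubset_refl _) (msuppD_le x y)).
rewrite (gr_mulw (fsubset_refl _) (fsubsetUl _ (msupp y))).
rewrite (gr_mulw (fsubset_refl _) (fsubsetUr (msupp x) _)).
rewrite -big_split; apply: eq_bigr => g _.
rewrite -big_split; apply: eq_bigr => h _ /=.
by rewrite mcoeffD mulrDr monalgUD.
Qed.

Lemma gr_mul0 x : gr_mul 0 x = 0.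
Proof. by rewrite gr_mul.unlock msupp0 big_seq_fset0. Qed.

Lemma gr_mulr0 x : gr_mul x 0 = 0.
Proof. by rewrite gr_mul.unlock big1 // => g _; rewrite msupp0 big_seq_fset0. Qed.

Lemma gr_mul_suml (I : Type) (r : seq I) (F : I -> {malg R[G]}) y :
  gr_mul (\sum_(i <- r) F i) y = \sum_(i <- r) gr_mul (F i) y.
Proof.
exact: (big_morph (gr_mul^~ y) (fun _ _ => gr_mulDl _ _ _) (gr_mul0 _)).
Qed.

Lemma gr_mul_sumr (I : Type) (r : seq I) (F : I -> {malg R[G]}) y :
  gr_mul y (\sum_(i <- r) F i) = \sum_(i <- r) gr_mul y (F i).
Proof.
exact: (big_morph (gr_mul y) (fun _ _ => gr_mulDr _ _ _) (gr_mulr0 _)).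
Qed.

Lemma gr_mulUU c d g h :
  gr_mul << c *g g >> << d *g h >> = << c * d *g (g * h)%g >>.
Proof.
by rewrite (gr_mulw msuppU_le msuppU_le) !big_seq_fset1 !mcoeffUU.
Qed.

Lemma gr_mul1 : left_id gr_one gr_mul.
Proof.
move=> x; rewrite gmon.unlock {1}[x]monalgE gr_mul_sumr [RHS]monalgE.
by apply: eq_bigr => g _; rewrite gr_mulUU mul1r mul1g.
Qed.

Lemma gr_mulr1 : right_id gr_one gr_mul.
Proof.
move=> x; rewrite gmon.unlock {1}[x]monalgE gr_mul_suml [RHS]monalgE.
by apply: eq_bigr => g _; rewrite gr_mulUU mulr1 mulg1.
Qed.

Lemma gr_mulA : associative gr_mul.
Proof.
move=> x y z; rewrite [x]monalgE !gr_mul_suml; apply: eq_bigr => g _.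
rewrite [y]monalgE gr_mul_suml !gr_mul_sumr gr_mul_suml.
apply: eq_bigr => h _; rewrite [z]monalgE !gr_mul_sumr.
by apply: eq_bigr => k _; rewrite !gr_mulUU mulrA mulgA.
Qed.

Lemma gr_one_neq0 : gr_one != 0.
Proof. by rewrite gmon.unlock monalgU_eq0 oner_eq0. Qed.

End GroupRingOps.

Section GroupRing.

Variables (R : nzRingType) (G : groupType).

HB.instance Definition _ := GRing.Lmodule.copy (grpring R G) {malg R[G]}.
HB.instance Definition _ := GRing.Zmodule_isNzRing.Build (grpring R G)
  (@gr_mulA R G) (@gr_mul1 R G) (@gr_mulr1 R G)
  (@gr_mulDl R G) (@gr_mulDr R G) (@gr_one_neq0 R G).

Definition gcoef (g : G) (x : grpring R G) : R := mcoeff g x.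

Definition gsupp (x : grpring R G) : {fset G} := msupp x.

Lemma gmonM c d g h : gmon c g * gmon d h = gmon (c * d) (g * h)%g.
Proof. by rewrite gmon.unlock; apply: gr_mulUU. Qed.

Lemma gmon1M g h : gmon 1 (g * h)%g = gmon 1 g * gmon 1 h.
Proof. by rewrite gmonM mulr1. Qed.

Lemma gmon1 : gmon 1 1%g = 1.
Proof. by []. Qed.

Lemma gmonD g : {morph gmon^~ g : c d / c + d}.
Proof. by move=> c d; rewrite gmon.unlock; apply: monalgUD. Qed.

Lemma grpringE x : x = \sum_(g <- gsupp x) gmon (gcoef g x) g.
Proof. by rewrite gmon.unlock; apply: monalgE. Qed.

Lemma gcoefP x y : (forall g, gcoef g x = gcoef g y) <-> x = y.
Proof. exact: malgP. Qed.

Lemma gcoefD g : {morph gcoef g : x y / x + y}.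
Proof. by move=> x y; apply: mcoeffD. Qed.

Lemma gcoef_mon g c h : gcoef g (gmon c h) = c *+ (h == g).
Proof. by rewrite gmon.unlock; apply: mcoeffU. Qed.

Lemma gcoefM g x y :
  gcoef g (x * y) = \sum_(h <- gsupp x) \sum_(k <- gsupp y)
                      (gcoef h x * gcoef k y) *+ (h * k == g)%g.
Proof.
rewrite /gcoef [X in mcoeff g X](_ : _ = gr_mul x y) // gr_mul.unlock raddf_sum.
apply: eq_bigr => h _; rewrite raddf_sum; apply: eq_bigr => k _.
exact: mcoeffU.
Qed.

Lemma gsuppE x g : (g \in gsupp x) = (gcoef g x != 0).
Proof. by rewrite /gsupp -mcoeff_neq0. Qed.

End GroupRing.

Section LinearExtension.

Variables (G : groupType) (V : zmodType) (f : G -> V).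

Definition linext (x : grpring int G) : V :=
  \sum_(g <- gsupp x) f g *~ gcoef g x.

Lemma linextw (A : {fset G}) x : (gsupp x `<=` A)%fset ->
  linext x = \sum_(g <- A) f g *~ gcoef g x.
Proof.
move=> xA; rewrite /linext (big_fset_incl _ xA) // => g _.
by rewrite gsuppE negbK => /eqP->; rewrite mulr0z.
Qed.

Lemma linextD : {morph linext : x y / x + y}.
Proof.
move=> x y; rewrite (linextw (msuppD_le x y)).
rewrite (linextw (fsubsetUl _ (gsupp y))) (linextw (fsubsetUr (gsupp x) _)).
by rewrite -big_split; apply: eq_bigr => g _ /=; rewrite gcoefD mulrzDr.
Qed.

Lemma linext_mon c g : linext (gmon c g) = f g *~ c.
Proof.
have gA : (gsupp (gmon c g) `<=` [fset g])%fset.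
  by rewrite gmon.unlock; apply: msuppU_le.
by rewrite (linextw gA) big_seq_fset1 gcoef_mon eqxx.
Qed.

Fact linext0 : linext 0 = 0.
Proof. by rewrite /linext /gsupp msupp0 big_seq_fset0. Qed.

HB.instance Definition _ := GRing.isSemiAdditive.Build (grpring int G) V linext
  (conj linext0 linextD).

End LinearExtension.

Section FoxDerivative.

Variables (X : choiceType) (j : X).

Notation F := (freegroup X).
Notation ZF := (grpring int F).

(* The values on letters are forced: d(x^-1)/dx = - x^-1. *)
Definition fox_letter (a : X * bool) : ZF :=
  if a.1 == j then if a.2 then - gmon 1 (fgen a.1)^-1%g else 1 else 0.

Fixpoint fox_word (w : seq (X * bool)) : ZF :=
  if w is a :: w' then
    fox_letter a + gmon 1 (leval (@fgen X) a) * fox_word w'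
  else 0.

Definition fox : ZF -> ZF := linext (fun g => fox_word (fword g)).

HB.instance Definition _ := GRing.Additive.on fox.

Lemma fox_gen i : fox (gmon 1 (fgen i)) = (i == j)%:R.
Proof.
by rewrite /fox linext_mon /= mulr0 addr0 /fox_letter /=; case: (i == j).
Qed.

Lemma fox_push a w : reduced w ->
  fox_word (push a w) = fox_letter a + gmon 1 (leval (@fgen X) a) * fox_word w.
Proof.
case: w => [|b w] //= red_bw; case: eqP => [->|_] //=.
rewrite mulrDr mulrA gmonM mulr1 leval_inv mulgV gmon1 mul1r addrA.
rewrite [X in _ = X + _](_ : _ = 0) ?add0r //.
case: a => x [] /=; rewrite /fox_letter /leval /=; case: eqP => [->|_].
- by rewrite mulr1 addNr.
- by rewrite mulr0 addr0.
- by rewrite mulrN gmonM mulr1 mulgV gmon1 subrr.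
- by rewrite mulr0 addr0.
Qed.

Lemma fox_word_foldr u w : reduced w ->
  fox_word (foldr (@push X) w u) =
    fox_word u + gmon 1 (\prod_(a <- u) leval (@fgen X) a)%g * fox_word w.
Proof.
move=> red_w; elim: u => [|a u IHu] /=; first by rewrite big_nil gmon1 mul1r add0r.
rewrite fox_push; last exact: reduced_foldr.
by rewrite IHu big_cons gmon1M mulrDr mulrA addrA.
Qed.

Lemma foxU g : fox (gmon 1 g) = fox_word (fword g).
Proof. by rewrite /fox linext_mon mulr1z. Qed.

Lemma foxM g h :
  fox (gmon 1 (g * h)%g) = fox (gmon 1 g) + gmon 1 g * fox (gmon 1 h).
Proof.
rewrite !foxU -[X in gmon 1 X]fg_eval_id.
exact: fox_word_foldr (fword_reduced h).
Qed.

End FoxDerivative.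

(* The infinite cyclic group <z>, written additively on exponents. *)
Definition zgrp : Type := int.
HB.instance Definition _ := Choice.on zgrp.
HB.instance Definition _ := isGroup.Build zgrp
  (@addrA int) (@add0r int) (@addr0 int) (@addNr int) (@addrN int).

Definition zgen : zgrp := 1%:Z.

(* Laurent polynomials R[z, z^-1], as the group ring of <z>. *)
Definition laurent (R : comNzRingType) : Type := grpring R zgrp.

HB.instance Definition _ (R : comNzRingType) := GRing.NzRing.on (laurent R).

HB.lock Definition laurent_inv (R : comNzRingType) (x : laurent R) : laurent R :=
  if pselect (exists y : laurent R, y * x = 1) is left inv_x then sval (cid inv_x)
  else x.

Section LaurentComRing.

Variable R : comNzRingType.

Fact laurent_mulC : commutative (@GRing.mul (laurent R)).
Proof.
move=> x y; apply/gcoefP => g; rewrite !gcoefM exchange_big.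
apply: eq_bigr => h _; apply: eq_bigr => k _.
by rewrite mulrC; congr (_ *+ (_ == _)); apply: (@addrC int).
Qed.

HB.instance Definition _ :=
  GRing.PzRing_hasCommutativeMul.Build (laurent R) laurent_mulC.

Definition laurent_unit (x : laurent R) : bool := `[< exists y, y * x = 1 >].

Fact laurent_mulVr : {in laurent_unit, left_inverse 1 (@laurent_inv R) *%R}.
Proof.
move=> x /asboolP Ux; rewrite laurent_inv.unlock; case: pselect => // inv_x.
by case: cid.
Qed.

Fact laurent_unitP (x y : laurent R) : y * x = 1 -> laurent_unit x.
Proof. by move=> yx; apply/asboolP; exists y. Qed.

Fact laurent_invr_out : {in [predC laurent_unit], @laurent_inv R =1 id}.
Proof.
by move=> x /asboolPn Ux; rewrite laurent_inv.unlock; case: pselect.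
Qed.

HB.instance Definition _ := GRing.ComNzRing_hasMulInverse.Build (laurent R)
  laurent_mulVr laurent_unitP laurent_invr_out.

Definition lconst (c : R) : laurent R := gmon c 1%g.

Definition lmon (k : zgrp) : laurent R := gmon 1 k.

Fact lconst0 : lconst 0 = 0.
Proof. by rewrite /lconst gmon.unlock; apply: monalgU0. Qed.

Fact lconst_morph : monoid_morphism lconst.
Proof. by split=> // c d; rewrite /lconst gmonM mulg1. Qed.

HB.instance Definition _ := GRing.isSemiAdditive.Build R (laurent R) lconst
  (conj lconst0 (gmonD _)).
HB.instance Definition _ :=
  GRing.isMonoidMorphism.Build R (laurent R) lconst lconst_morph.

Lemma lmonM k l : lmon (k * l)%g = lmon k * lmon l.
Proof. by rewrite /lmon gmonM mulr1. Qed.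

Lemma lmon1 : lmon 1%g = 1.
Proof. by []. Qed.

Lemma lmon_unit k : lmon k \is a GRing.unit.
Proof. by apply/unitrP; exists (lmon k^-1%g); rewrite -!lmonM mulVg mulgV. Qed.

End LaurentComRing.

Section LaurentDomain.

Variable R : idomainType.

Lemma seq_int_max (s : seq int) : s != [::] ->
  exists2 m, m \in s & {in s, forall k, k <= m}.
Proof.
elim: s => // a [|b s] IHs _.
  by exists a; rewrite ?mem_head // => k; rewrite inE => /eqP->.
have [m ms lem] := IHs isT; case: (lerP m a) => [le_ma|/ltW le_am].
  exists a; rewrite ?mem_head // => k; rewrite inE => /predU1P[->//|ks].
  exact: le_trans (lem k ks) le_ma.
exists m; first by rewrite inE ms orbT.
by move=> k; rewrite inE => /predU1P[->//|]; apply: lem.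
Qed.

Lemma laurent_top (x : laurent R) : x != 0 ->
  exists2 m : zgrp, m \in gsupp x &
    forall k : zgrp, k \in gsupp x -> (k : int) <= (m : int).
Proof.
move=> x_neq0; apply: seq_int_max; apply: contra x_neq0 => /eqP x0.
by rewrite [x]grpringE x0 big_nil.
Qed.

Fact laurent_mulf_eq0 (x y : laurent R) : x * y = 0 -> (x == 0) || (y == 0).
Proof.
move=> xy0; case: (eqVneq x 0) => //= x0; case: (eqVneq y 0) => // y0.
have [m mx lem] := laurent_top x0; have [n ny len] := laurent_top y0.
have: gcoef (m * n)%g (x * y) = 0.
  by rewrite xy0; apply: mcoeff0.
rewrite gcoefM (big_fsetD1 _ mx) /= (big_fsetD1 _ ny) /= eqxx.
rewrite [X in _ + X + _]big_seq [X in _ + X + _]big1 ?addr0; last first.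
  move=> k; rewrite !inE => /andP[kn /len le_kn].
  by case: eqP => // /(@addrI int m)/eqP; rewrite (negbTE kn).
rewrite [X in _ + X]big_seq [X in _ + X]big1 ?addr0; last first.
  move=> h; rewrite !inE => /andP[hm /lem le_hm].
  rewrite big_seq big1 // => k /len le_kn; case: eqP => //= eq_hk.
  have : (h : int) + (k : int) < (m : int) + (n : int) by apply: ltr_leD; rewrite // lt_neqAle hm.
  by rewrite [(h : int) + (k : int)]eq_hk ltxx.
move/eqP; rewrite mulf_eq0; move: mx ny; rewrite !gsuppE.
by move=> /negbTE-> /negbTE->.
Qed.

HB.instance Definition _ :=
  GRing.ComUnitRing_isIntegral.Build (laurent R) laurent_mulf_eq0.

End LaurentDomain.

Definition GL (N : nat) (R : comUnitRingType) : Type := {A : 'M[R]_N | A \in unitmx}.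

Section GL.

Variables (N : nat) (R : comUnitRingType).

HB.instance Definition _ := Choice.on (GL N R).

Definition GLmx (A : GL N R) : 'M[R]_N := sval A.

Lemma GL_unit (A : GL N R) : GLmx A \in unitmx.
Proof. exact: (svalP A). Qed.

Fact GL1_subproof : (1%:M : 'M[R]_N) \in unitmx.
Proof. exact: unitmx1. Qed.

Fact GLM_subproof (A B : GL N R) : GLmx A *m GLmx B \in unitmx.
Proof. by rewrite unitmx_mul !GL_unit. Qed.

Fact GLV_subproof (A : GL N R) : invmx (GLmx A) \in unitmx.
Proof. by rewrite unitmx_inv GL_unit. Qed.

Definition GL_one : GL N R := Sub 1%:M GL1_subproof.
Definition GL_mul (A B : GL N R) : GL N R := Sub (GLmx A *m GLmx B) (GLM_subproof A B).
Definition GL_inv (A : GL N R) : GL N R := Sub (invmx (GLmx A)) (GLV_subproof A).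

Fact GL_mulA : associative GL_mul.
Proof. by move=> A B C; apply: val_inj; apply: mulmxA. Qed.

Fact GL_mul1 : left_id GL_one GL_mul.
Proof. by move=> A; apply: val_inj; apply: mul1mx. Qed.

Fact GL_mulr1 : right_id GL_one GL_mul.
Proof. by move=> A; apply: val_inj; apply: mulmx1. Qed.

Fact GL_mulV : left_inverse GL_one GL_inv GL_mul.
Proof. by move=> A; apply: val_inj; apply: mulVmx (GL_unit A). Qed.

Fact GL_mulrV : right_inverse GL_one GL_inv GL_mul.
Proof. by move=> A; apply: val_inj; apply: mulmxV (GL_unit A). Qed.

HB.instance Definition _ :=
  isGroup.Build (GL N R) GL_mulA GL_mul1 GL_mulr1 GL_mulV GL_mulrV.

Lemma GLmxM (A B : GL N R) : GLmx (A * B)%g = GLmx A *m GLmx B.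
Proof. by []. Qed.

Lemma GLmx_inj : injective GLmx.
Proof. exact: val_inj. Qed.

End GL.

Section WeldedBraidGroup.

Variable n : nat.

Notation FW := (freegroup 'I_(n.-1 + n.-1)).

Implicit Types (i j : 'I_n.-1).

(* sigma_1, ..., sigma_{n-1}, tau_1, ..., tau_{n-1}, indexed from 0. *)
Definition wsigma i : FW := fgen (lshift n.-1 i).
Definition wtau i : FW := fgen (rshift n.-1 i).

(* the j with |i - j| >= 2 *)
Definition far i : seq 'I_n.-1 :=
  [seq j : 'I_n.-1 <- enum 'I_n.-1 | (i + 2 <= j)%N || (j + 2 <= i)%N].

Definition succ_of i : seq 'I_n.-1 := [seq j : 'I_n.-1 <- enum 'I_n.-1 | j == i.+1 :> nat].

Local Open Scope group_scope.

(* A relation u = v is encoded by the relator u v^-1. *)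
Definition welded_relators : seq FW :=
  [seq (wsigma i * wsigma j) / (wsigma j * wsigma i)
       | i <- enum 'I_n.-1, j <- far i]
  ++ [seq (wtau i * wtau j) / (wtau j * wtau i)
       | i <- enum 'I_n.-1, j <- far i]
  ++ [seq (wsigma i * wtau j) / (wtau j * wsigma i)
       | i <- enum 'I_n.-1, j <- far i]
  ++ [seq wtau i * wtau i | i <- enum 'I_n.-1]
  ++ [seq (wsigma i * wsigma j * wsigma i) / (wsigma j * wsigma i * wsigma j)
       | i <- enum 'I_n.-1, j <- succ_of i]
  ++ [seq (wtau i * wtau j * wtau i) / (wtau j * wtau i * wtau j)
       | i <- enum 'I_n.-1, j <- succ_of i]
  ++ [seq (wsigma i * wtau j * wtau i) / (wtau j * wtau i * wsigma j)
       | i <- enum 'I_n.-1, j <- succ_of i]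
  ++ [seq (wtau i * wsigma j * wsigma i) / (wsigma j * wsigma i * wtau j)
       | i <- enum 'I_n.-1, j <- succ_of i].

Definition welded_presentation : presentation := Presentation welded_relators.

Definition WB : groupType := presgroup welded_presentation.

Definition sigma i : WB := @pgen welded_presentation (lshift n.-1 i).
Definition tau i : WB := @pgen welded_presentation (rshift n.-1 i).

Section Lift.

Variables (H : groupType) (s t : 'I_n.-1 -> H).

Definition welded_map (k : 'I_(n.-1 + n.-1)) : H :=
  match split k with inl i => s i | inr i => t i end.

Lemma welded_map_sigma i : fg_eval welded_map (wsigma i) = s i.
Proof. by rewrite fg_eval_gen /welded_map (unsplitK (inl i)). Qed.

Lemma welded_map_tau i : fg_eval welded_map (wtau i) = t i.
Proof. by rewrite fg_eval_gen /welded_map (unsplitK (inr i)). Qed.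

Hypothesis ssC : forall i j, (i + 2 <= j)%N || (j + 2 <= i)%N -> s i * s j = s j * s i.
Hypothesis ttC : forall i j, (i + 2 <= j)%N || (j + 2 <= i)%N -> t i * t j = t j * t i.
Hypothesis stC : forall i j, (i + 2 <= j)%N || (j + 2 <= i)%N -> s i * t j = t j * s i.
Hypothesis tt1 : forall i, t i * t i = 1.
Hypothesis sss : forall i j, j = i.+1 :> nat -> s i * s j * s i = s j * s i * s j.
Hypothesis ttt : forall i j, j = i.+1 :> nat -> t i * t j * t i = t j * t i * t j.
Hypothesis stt : forall i j, j = i.+1 :> nat -> s i * t j * t i = t j * t i * s j.
Hypothesis tss : forall i j, j = i.+1 :> nat -> t i * s j * s i = s j * s i * t j.

Lemma welded_mapP r : r \in relators welded_presentation -> fg_eval welded_map r = 1.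
Proof.
have E := (welded_map_sigma, welded_map_tau).
rewrite /= !mem_cat => /or4P[||| /or4P[|||/orP[]]];
  try (case/allpairsPdep=> i [j] []; rewrite ?mem_filter => _ /andP[ij _] ->);
  try (case/mapP=> i _ ->).
- by rewrite gmulfF !gmulfM /= !E ssC // divgg.
- by rewrite gmulfF !gmulfM /= !E ttC // divgg.
- by rewrite gmulfF !gmulfM /= !E stC // divgg.
- by rewrite gmulfM /= !E tt1.
- by rewrite gmulfF !gmulfM /= !E sss ?divgg //; apply/eqP.
- by rewrite gmulfF !gmulfM /= !E ttt ?divgg //; apply/eqP.
- by rewrite gmulfF !gmulfM /= !E stt ?divgg //; apply/eqP.
- by rewrite gmulfF !gmulfM /= !E tss ?divgg //; apply/eqP.
Qed.

End Lift.

End WeldedBraidGroup.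

Section WeldedDegree.

Variable n : nat.

Let s (i : 'I_n.-1) : zgrp := zgen.
Let t (i : 'I_n.-1) : zgrp := 1%g.

Fact welded_deg_rel r :
  r \in relators (welded_presentation n) -> fg_eval (welded_map s t) r = 1%g.
Proof. by apply: welded_mapP. Qed.

Definition welded_deg : {multiplicative WB n -> zgrp} := pres_lift welded_deg_rel.

Lemma welded_deg_sigma i : welded_deg (sigma i) = zgen.
Proof. by rewrite /welded_deg /= pres_lift_gen /welded_map (unsplitK (inl i)). Qed.

Lemma welded_deg_tau i : welded_deg (tau i) = 1%g.
Proof. by rewrite /welded_deg /= pres_lift_gen /welded_map (unsplitK (inr i)). Qed.

Lemma welded_deg_surj (k : zgrp) : (2 <= n)%N -> exists x, welded_deg x = k.
Proof.
move=> n2; have n1 : (0 < n.-1)%N by lia.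
pose x := sigma (Ordinal n1).
have pow p : welded_deg (x ^+ p)%g = (p%:Z : zgrp).
  elim: p => [|p IHp].
    apply: (@mulgI _ (welded_deg 1%g)); rewrite -gmulfM mulg1; exact: esym (addr0 _).
  by rewrite expgS gmulfM IHp welded_deg_sigma; apply: esym; apply: intS.
case: k => p; first by exists (x ^+ p)%g.
exists ((x ^+ p.+1)^-1)%g; apply: (@mulgI _ (welded_deg (x ^+ p.+1)%g)).
rewrite -gmulfM mulgV pow; move: (pow 0); rewrite expg0 => ->.
by rewrite NegzE; apply: esym; apply: (@addrN int).
Qed.

End WeldedDegree.

Section BlockMatrices.

Variables (R : comNzRingType) (n : nat).

Implicit Types (i j : 'I_n.-1) (b c : R) (p q : nat -> nat) (v w : nat -> R).

(* I_i (+) [0 b; c 0] (+) I_{n-i-2}, with i counted from 0. *)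
Definition blk i b c : 'M[R]_n := \matrix_(r, k)
  if r == i :> nat then b *+ (k == i.+1 :> nat)
  else if r == i.+1 :> nat then c *+ (k == i :> nat)
  else (r == k)%:R.

Definition mono p w : 'M[R]_n := \matrix_(r, k) (w r *+ (k == p r :> nat)).

Lemma mono_mul p q v w : (forall r, (r < n)%N -> (p r < n)%N) ->
  mono p v *m mono q w = mono (fun r => q (p r)) (fun r => v r * w (p r)).
Proof.
move=> p_lt; apply/matrixP=> r k; rewrite !mxE.
rewrite (bigD1 (Ordinal (p_lt r (ltn_ord r)))) //= big1 => [|l /eqP lr].
  by rewrite !mxE /= eqxx addr0 mulrnAr.
rewrite !mxE; case: eqP => [lpr|_]; last by rewrite mul0r.
by case: lr; apply: val_inj.
Qed.

Lemma eq_mono p q v w : (forall r, (r < n)%N -> p r = q r /\ v r = w r) ->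
  mono p v = mono q w.
Proof.
by move=> E; apply/matrixP=> r k; rewrite !mxE; have [-> ->] := E r (ltn_ord r).
Qed.

Lemma mono1 p w : (forall r, (r < n)%N -> p r = r /\ w r = 1) -> mono p w = 1%:M.
Proof.
move=> E; apply/matrixP=> r k; rewrite !mxE; have [-> ->] := E r (ltn_ord r).
by rewrite eq_sym.
Qed.

Definition swap i (r : nat) : nat :=
  if r == i then i.+1 else if r == i.+1 then i : nat else r.

Definition weight i b c (r : nat) : R :=
  if r == i then b else if r == i.+1 then c else 1.

Lemma blkE i b c : blk i b c = mono (swap i) (weight i b c).
Proof.
apply/matrixP=> r k; rewrite !mxE /swap /weight.
by do 2!case: ifP => // _; rewrite eq_sym.
Qed.

Lemma swap_lt i r : (r < n)%N -> (swap i r < n)%N.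
Proof. by rewrite /swap; have := ltn_ord i; case: eqP => _; [|case: eqP => _]; lia. Qed.

Local Ltac case_eq_op :=
  match goal with |- context [@eq_op _ ?x ?y] =>
    lazymatch x with context [if _ then _ else _] => fail
    | _ => case: (@eqP _ x y) => /= ? end end.

Let swap_lt2 i j r : (r < n)%N -> (swap j (swap i r) < n)%N.
Proof. by move=> rn; do 2!apply: swap_lt. Qed.

Lemma blk_inv i b c b' c' : b * c' = 1 -> c * b' = 1 ->
  blk i b c *m blk i b' c' = 1%:M.
Proof.
move=> bc cb; rewrite !blkE mono_mul; last exact: swap_lt.
apply: mono1 => r _; rewrite /swap /weight.
split; repeat case_eq_op; rewrite ?mulr1 //; try lia; exfalso; lia.
Qed.

Lemma blkC i j b c b' c' : (i + 2 <= j)%N || (j + 2 <= i)%N ->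
  blk i b c *m blk j b' c' = blk j b' c' *m blk i b c.
Proof.
move=> ij; rewrite !blkE !mono_mul; try exact: swap_lt.
apply: eq_mono => r _; rewrite /swap /weight.
split; repeat case_eq_op; rewrite ?(mulr1, mul1r) //; try lia; exfalso; lia.
Qed.

Lemma blk_braid i j b c b' c' : j = i.+1 :> nat ->
  blk i b c *m blk j b' c' *m blk i b' c' =
    blk j b' c' *m blk i b' c' *m blk j b c.
Proof.
move=> ij; rewrite !blkE !mono_mul; try exact: swap_lt; try exact: swap_lt2.
apply: eq_mono => r _; rewrite /swap /weight.
split; repeat case_eq_op; rewrite ?(mulr1, mul1r) //; try lia;
  first [by rewrite mulrC | exfalso; lia].
Qed.

End BlockMatrices.

Lemma blk_unitmx (R : comUnitRingType) n (i : 'I_n.-1) (b c : R) :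
  b \is a GRing.unit -> c \is a GRing.unit -> blk i b c \in unitmx.
Proof.
by move=> Ub Uc; have [] := mulmx1_unit (blk_inv i (mulrV Ub) (mulrV Uc)).
Qed.

Lemma blk_sqr (R : comUnitRingType) n (i : 'I_n.-1) (a : R) :
  a \is a GRing.unit -> blk i a^-1 a *m blk i a^-1 a = 1%:M.
Proof. by move=> Ua; apply: blk_inv; rewrite ?mulVr ?mulrV. Qed.

Section TongYangMa.

Variable n : nat.

(* Z[t, t^-1, a, a^-1]: t is the inner variable, a the outer one. *)
Definition ZTA : idomainType := laurent (laurent int).

Definition tvar : ZTA := lconst (lmon int zgen).
Definition avar : ZTA := lmon (laurent int) zgen.

Fact tvar_unit : tvar \is a GRing.unit.
Proof. exact: rmorph_unit (lmon_unit _ _). Qed.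

Fact avar_unit : avar \is a GRing.unit.
Proof. exact: lmon_unit. Qed.

Fact TYM_sigma_unit (i : 'I_n.-1) : blk i 1 tvar \in unitmx.
Proof. by apply: blk_unitmx; [apply: unitr1 | apply: tvar_unit]. Qed.

Fact TYM_tau_unit (i : 'I_n.-1) : blk i avar^-1 avar \in unitmx.
Proof. by apply: blk_unitmx; rewrite ?unitrV avar_unit. Qed.

Definition TYM_sigma (i : 'I_n.-1) : GL n ZTA := Sub (blk i 1 tvar) (TYM_sigma_unit i).
Definition TYM_tau (i : 'I_n.-1) : GL n ZTA := Sub (blk i avar^-1 avar) (TYM_tau_unit i).

Fact wTYM_rel r : r \in relators (welded_presentation n) ->
  fg_eval (welded_map TYM_sigma TYM_tau) r = 1%g.
Proof.
apply: welded_mapP => [i j ij|i j ij|i j ij|i|i j ij|i j ij|i j ij|i j ij];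
  apply: GLmx_inj; rewrite ?GLmxM /=.
- exact: blkC.
- exact: blkC.
- exact: blkC.
- exact: blk_sqr avar_unit.
- exact: blk_braid.
- exact: blk_braid.
- exact: blk_braid.
- exact: blk_braid.
Qed.

Definition wTYM : {multiplicative WB n -> GL n ZTA} := pres_lift wTYM_rel.

Lemma wTYM_sigma i : GLmx (wTYM (sigma i)) = blk i 1 tvar.
Proof. by rewrite /wTYM /= pres_lift_gen /welded_map (unsplitK (inl i)). Qed.

Lemma wTYM_tau i : GLmx (wTYM (tau i)) = blk i avar^-1 avar.
Proof. by rewrite /wTYM /= pres_lift_gen /welded_map (unsplitK (inr i)). Qed.

End TongYangMa.

Definition divides (L : comNzRingType) (d x : L) : Prop := exists q, x = q * d.

(* g is a gcd of the family of the x i with P i; for an empty family, g = 0. *)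
Definition is_gcd (L : comNzRingType) (T : Type) (P : T -> Prop) (x : T -> L)
    (g : L) : Prop :=
  (forall i, P i -> divides g (x i)) /\
  (forall d, (forall i, P i -> divides d (x i)) -> divides d g).

Section TwistedAlexander.

Variables (P : presentation) (R : idomainType) (N : nat).
Variables (alpha : {multiplicative presgroup P -> zgrp}).
Variables (rho : {multiplicative presgroup P -> GL N R}).

Notation F := (freegroup 'I_(ngens P)).
Notation l := (ngens P).
Notation m := (size (relators P)).

Definition Phi_word (g : F) : 'M[laurent R]_N :=
  lmon R (alpha (pres_proj g)) *: map_mx (@lconst R) (GLmx (rho (pres_proj g))).

Definition Phi : grpring int F -> 'M[laurent R]_N := linext Phi_word.

HB.instance Definition _ := GRing.Additive.on Phi.

Lemma Phi_wordM g h : Phi_word (g * h)%g = Phi_word g *m Phi_word h.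
Proof.
rewrite /Phi_word !gmulfM GLmxM map_mxM lmonM.
by rewrite -scalemxAl -scalemxAr scalerA.
Qed.

Lemma Phi_mon c g : Phi (gmon c g) = Phi_word g *~ c.
Proof. exact: linext_mon. Qed.

Lemma Phi1 : Phi 1 = 1%:M.
Proof.
have alpha1 : alpha 1%g = 1%g.
  by apply: (@mulgI _ (alpha 1%g)); rewrite -gmulfM !mulg1.
have rho1 : rho 1%g = 1%g.
  by apply: (@mulgI _ (rho 1%g)); rewrite -gmulfM !mulg1.
rewrite -gmon1 Phi_mon /Phi_word gmulf1 /= alpha1 rho1 lmon1 scale1r.
exact: map_mx1.
Qed.

Lemma PhiM x y : Phi (x * y) = Phi x *m Phi y.
Proof.
rewrite [x]grpringE.
rewrite mulr_suml !(raddf_sum Phi) mulmx_suml; apply: eq_bigr => g _.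
rewrite [y]grpringE mulr_sumr !(raddf_sum Phi) mulmx_sumr.
apply: eq_bigr => h _ /=; rewrite gmonM !Phi_mon Phi_wordM.
move: (Phi_word g) (Phi_word h) => A B.
have ZE c M : M *~ c = c%:~R *: M :> 'M[laurent R]_N by rewrite scaler_int.
by rewrite !ZE intrM -scalemxAl -scalemxAr scalerA.
Qed.

(* Dropping the j-th block column: k |-> lift j k lists the columns k != j. *)
Definition alexander_mx (j : 'I_l) : 'M[laurent R]_(\sum_(i < m) N, \sum_(k < l.-1) N) :=
  \mxblock_(i < m, k < l.-1)
    Phi (fox (lift j k) (gmon 1 (nth 1%g (relators P) i))).

Definition row_choice : Type := 'I_(\sum_(k < l.-1) N) -> 'I_(\sum_(i < m) N).

Definition increasing (I : row_choice) : Prop :=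
  forall u v : 'I_(\sum_(k < l.-1) N), (u < v)%N -> (I u < I v)%N.

Definition alexander_minor (j : 'I_l) (I : row_choice) : laurent R :=
  \det (rowsub I (alexander_mx j)).

Definition alexander_denom (j : 'I_l) : laurent R :=
  \det (Phi (1 - gmon 1 (fgen j))).

(* Delta is a value of the twisted Alexander invariant of the presented group; *)
(* it depends on the choice of j and of a gcd, which exists when R is a UFD.   *)
Definition is_twisted_alexander (Delta : {fraction (laurent R)}) : Prop :=
  if (m < l.-1)%N then Delta = 0 else
  exists (j : 'I_l) (g : laurent R),
    [/\ alexander_denom j != 0,
        is_gcd increasing (alexander_minor j) g &
        Delta = tofrac g / tofrac (alexander_denom j)].

End TwistedAlexander.

(* Equality up to a factor e z^c, with e a unit of R. *)
Definition doteq (R : idomainType) (D E : {fraction (laurent R)}) : Prop :=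
  exists (e : R) (c : zgrp),
    e \is a GRing.unit /\ D = tofrac (lconst e * lmon R c) * E.

(* Main.v *)
Require Import Defs.
From HB Require Import structures.
From mathcomp Require Import all_boot all_order all_algebra.
From mathcomp Require Import fraction.
From mathcomp Require Import finmap monalg zify ring.

(* Since [det Phi(1 - tau_i) = 0], only the block column of [sigma_1] or of   *)
(* [sigma_2] can be dropped, and both choices have the denominator            *)
(* [D = (1 - z)(1 - t z^2)]. Each factor of [D] divides all the minors,       *)
(* because some vector with an invertible entry is mapped into its multiples. *)
(* Conversely, up to units, [D (1 - a z^2)(a^2 - t^2 z^2)] and                *)
(* [2 D (1 - t^2 z^6)] are minors. Their cofactors of [D] generate an ideal   *)
(* containing the nonzero constant [2 (a^3 - t^2)(t^4 - a^6)] of              *)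
(* [Z[t^+-1, a^+-1]], and the first one has an invertible leading coefficient *)
(* in [z], hence is prime to the constants; so the gcd of the minors is [D].  *)

Set Implicit Arguments.
Unset Strict Implicit.
Unset Printing Implicit Defensive.

Import Order.TTheory GRing.Theory Num.Theory.

Local Open Scope ring_scope.

(** * Laurent polynomials *)

(** For a block column of a [sigma] generator the denominator is [tym_denom], the product D = (1 -
    z) (1 - t z^2), so the invariant is 1 once D is shown to be a gcd of the 9 x 9 minors of the
    remaining 18 x 9 matrix. D divides every minor. By Fox's fundamental formula, the Alexander
    matrix kills the column of the blocks Phi(x_k - 1). If u is fixed by the dropped generator
    modulo one factor of D, the vectors (Phi(x_k) - 1) u for the other generators are therefore
    killed modulo that factor. A coordinate of this vector is invertible, and Cramer's rule
    ([divides_minors_ker]) makes the factor divide all minors. The two factors combine in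
    [tym_denom_divides]. Conversely, [divides_minors_trig] evaluates two minors as D times explicit
    cofactors, up to units. A common divisor of both divides D ([divides_tym_denom]), since the
    cofactors combine to a nonzero constant and one of them is coprime to constants
    ([unit_top_prime_to_const]). Finally, two gcds differ by a unit ([divides_eqv]), and the units
    of R[z, z^-1] are the e z^k ([laurent_unitE]), which is exactly the allowed indeterminacy. *)

Section Divides.

Variable L : comNzRingType.

Implicit Types c d x y : L.

Lemma divides_mull d c x : divides d x -> divides d (c * x).
Proof. by case=> q ->; exists (c * q); rewrite mulrA. Qed.

Lemma dividesD d x y : divides d x -> divides d y -> divides d (x + y).
Proof. by case=> q -> [q' ->]; exists (q + q'); rewrite mulrDl. Qed.

End Divides.

Section Laurent.

Variable R : idomainType.

Implicit Types (x y p q : laurent R) (c e : R) (k m n : zgrp).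

Lemma gsupp_eq0 k x : k \notin gsupp x -> gcoef k x = 0.
Proof. by rewrite gsuppE negbK => /eqP. Qed.

Lemma gcoefB k x y : gcoef k (x - y) = gcoef k x - gcoef k y.
Proof. exact: mcoeffB. Qed.

(** At extreme exponents the uniqueness hypothesis is automatic, so this makes leading and trailing
    coefficients multiplicative. *)
Lemma gcoefM_uniq m n x y :
  (forall h k, h \in gsupp x -> k \in gsupp y -> (h * k = m * n)%g ->
     h = m /\ k = n) ->
  gcoef (m * n)%g (x * y) = gcoef m x * gcoef n y.
Proof.
move=> U; rewrite gcoefM.
have [mx|/gsupp_eq0 mx] := boolP (m \in gsupp x); last first.
  rewrite mx mul0r big_seq big1 // => h hx; rewrite big_seq big1 // => k ky.
  by case: eqP => // /(U _ _ hx ky)[-> _]; rewrite mx mul0r.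
have [ny|/gsupp_eq0 ny] := boolP (n \in gsupp y); last first.
  rewrite ny mulr0 big_seq big1 // => h hx; rewrite big_seq big1 // => k ky.
  by case: eqP => // /(U _ _ hx ky)[_ ->]; rewrite ny mulr0.
rewrite (big_fsetD1 _ mx) /= (big_fsetD1 _ ny) /= eqxx.
rewrite [X in _ + X + _]big_seq [X in _ + X + _]big1 ?addr0; last first.
  move=> k; rewrite !inE => /andP[kn ky]; case: eqP => // E.
  by have [_ kE] := U _ _ mx ky E; rewrite kE eqxx in kn.
rewrite [X in _ + X]big_seq [X in _ + X]big1 ?addr0 // => h.
rewrite !inE => /andP[hm hx]; rewrite big_seq big1 // => k ky.
by case: eqP => // /(U _ _ hx ky)[hE _]; rewrite hE eqxx in hm.
Qed.

Lemma laurent_bot x : x != 0 ->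
  exists2 m : zgrp, m \in gsupp x &
    forall k : zgrp, k \in gsupp x -> (m : int) <= (k : int).
Proof.
move=> x0; have : [seq - (k : int) | k <- gsupp x] != [::].
  apply: contra x0; case E: (enum_fset (gsupp x)) => // _.
  by rewrite [x]grpringE E big_nil.
case/seq_int_max => _ /mapP[m mx ->] maxm; exists m => // k kx.
by rewrite -lerN2; apply/maxm/map_f.
Qed.

Lemma gcoef1 k : gcoef k (1 : laurent R) = (k == 1%g)%:R.
Proof. by rewrite -gmon1 gcoef_mon eq_sym. Qed.

(** The top exponents of x and of its inverse add up to 0, and so do the bottom ones; since bottom
    is at most top for both, they coincide and x is a single monomial. *)
Lemma laurent_unitE x : x \is a GRing.unit ->
  exists e k, e \is a GRing.unit /\ x = lconst e * lmon R k.
Proof.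
move=> Ux; have x0 : x != 0 by apply: contraTneq Ux => ->; rewrite unitr0.
have y0 : x^-1 != 0 by rewrite invr_eq0.
have [m mx max_m] := laurent_top x0; have [n ny max_n] := laurent_top y0.
have [m' mx' min_m] := laurent_bot x0; have [n' ny' min_n] := laurent_bot y0.
have addE (h k : zgrp) : (h * k)%g = (h : int) + (k : int) :> int by [].
have top : gcoef (m * n)%g (x * x^-1) = gcoef m x * gcoef n x^-1.
  apply: gcoefM_uniq => h k /max_m hm /max_n kn.
  by move/(congr1 (id : zgrp -> int)); rewrite /= !addE => E; split; lia.
have bot : gcoef (m' * n')%g (x * x^-1) = gcoef m' x * gcoef n' x^-1.
  apply: gcoefM_uniq => h k /min_m hm /min_n kn.
  by move/(congr1 (id : zgrp -> int)); rewrite /= !addE => E; split; lia.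
have nz0 : gcoef m x * gcoef n x^-1 != 0 by rewrite mulf_neq0 // -gsuppE.
have nz0' : gcoef m' x * gcoef n' x^-1 != 0 by rewrite mulf_neq0 // -gsuppE.
have mn : (m * n)%g = 1%g.
  by apply: contraNeq (nz0) => neq1; rewrite -top divrr // gcoef1 (negPf neq1).
have mn' : (m' * n')%g = 1%g.
  by apply: contraNeq (nz0') => neq1; rewrite -bot divrr // gcoef1 (negPf neq1).
have mm : m' = m.
  have := max_m _ mx'; have := max_n _ ny'.
  have : (m : int) + (n : int) = (m' : int) + (n' : int) by rewrite -!addE mn mn'.
  by move=> E le1 le2; have : (m' : int) = m by lia.
have Ue : gcoef m x \is a GRing.unit.
  apply/unitrP; exists (gcoef n x^-1); rewrite [X in X = _ /\ _]mulrC.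
  by rewrite -top divrr // gcoef1 mn eqxx.
exists (gcoef m x), m; split=> //; rewrite /lconst /lmon gmonM mulr1 mul1g.
apply/gcoefP => k; rewrite gcoef_mon; case: eqP => [<-//|mk]; rewrite mulr0n.
apply/gsupp_eq0/negP => kx; case: mk.
have := max_m _ kx; have := min_m _ kx; rewrite mm => le1 le2.
by apply/eqP; rewrite (_ : (m == k) = ((m : int) == k)) // eq_le le1 le2.
Qed.

Lemma divides_eqv x y : y != 0 -> divides x y -> divides y x ->
  exists2 u, u \is a GRing.unit & x = u * y.
Proof.
move=> y0 [q yE] [u xE]; exists u => //; apply/unitrP; exists q.
have: (q * u - 1) * y = 0 by rewrite mulrBl mul1r -mulrA -xE -yE subrr.
by move/eqP; rewrite mulf_eq0 (negPf y0) orbF subr_eq0 mulrC => /eqP->.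
Qed.

(** An invertible leading coefficient plays the part of primitivity in Gauss's lemma, over an
    arbitrary domain. *)
Definition unit_top p : Prop :=
  exists2 n : zgrp, gcoef n p \is a GRing.unit &
    forall k : zgrp, k \in gsupp p -> (k : int) <= (n : int).

(** The leading coefficient of p x is a unit times that of x, so c divides the leading coefficient
    of x. Removing the top monomial of x shrinks its support, which drives the induction. *)
Lemma divides_const_unit_top c p x :
  unit_top p -> divides (lconst c) (p * x) -> divides (lconst c) x.
Proof.
case=> n Un max_n; have [N] := ubnP #|` gsupp x|.
elim: N x => // N IHN x /ltnSE-le_x [w wE].
have [->|x0] := eqVneq x 0; first by exists 0; rewrite mul0r.
have [m mx max_m] := laurent_top x0.
have addE (h k : zgrp) : (h * k)%g = (h : int) + (k : int) :> int by [].
have top : gcoef (n * m)%g (p * x) = gcoef n p * gcoef m x.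
  apply: gcoefM_uniq => h k /max_n hm /max_m kn.
  by move/(congr1 (id : zgrp -> int)); rewrite /= !addE => E; split; lia.
have lcE k y : gcoef k (y * lconst c) = gcoef k y * c.
  rewrite /lconst -[k in LHS]mulg1 gcoefM_uniq ?gcoef_mon ?eqxx // => h l _.
  by rewrite gsuppE gcoef_mon; case: (1%g =P l) => [<- _|_]; rewrite ?eqxx // !mulg1.
(* This is the quotient by c of the leading coefficient of x, read off from p x = w c at the
   exponent [n * m]. *)
pose e := (gcoef n p)^-1 * gcoef (n * m)%g w.
have xm : gcoef m x = e * c.
  by rewrite /e -mulrA -lcE -wE top mulKr.
have xB k : gcoef k (x - gmon (gcoef m x) m) = if k == m then 0 else gcoef k x.
  rewrite gcoefB gcoef_mon [m == k]eq_sym.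
  by case: (k =P m) => [->|_]; rewrite ?subrr ?subr0.
have : divides (lconst c) (x - gmon (gcoef m x) m).
  apply: IHN.
    apply: leq_trans le_x; rewrite (cardfsD1 m (gsupp x)) mx ltnS.
    apply/fsubset_leq_card/fsubsetP => k; rewrite !inE !gsuppE xB.
    by case: (k == m); rewrite ?eqxx.
  exists (w - p * gmon e m).
  by rewrite mulrBr mulrBl -wE -mulrA /lconst gmonM mulg1 -xm.
move=> dx; rewrite -[x](subrK (gmon (gcoef m x) m)); apply: dividesD => //.
by exists (gmon e m); rewrite /lconst gmonM mulg1 xm.
Qed.

Definition prime_to_const p : Prop :=
  forall c x, c != 0 -> divides p (lconst c * x) -> divides p x.

Lemma lconst_eq0 c : (lconst c == 0) = (c == 0).
Proof.
apply/eqP/eqP => [|->]; last exact: raddf0.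
by move/(congr1 (gcoef 1%g)); rewrite gcoef_mon eqxx [RHS]mcoeff0.
Qed.

(** If c x = w p, then c divides w by the previous divisibility, and c cancels. *)
Lemma unit_top_prime_to_const p : unit_top p -> prime_to_const p.
Proof.
move=> top_p c x c0 [w wE].
have [w' w'E] : divides (lconst c) w.
  by apply: divides_const_unit_top top_p _; exists x; rewrite mulrC -wE mulrC.
exists w'; apply: (@mulfI _ (lconst c)); first by rewrite lconst_eq0.
by rewrite wE w'E; ring.
Qed.

Lemma prime_to_constM p q : p != 0 ->
  prime_to_const p -> prime_to_const q -> prime_to_const (p * q).
Proof.
move=> p0 prim_p prim_q c x c0 [w wE].
have [x' x'E] : divides p x.
  by apply: (prim_p c) => //; exists (w * q); rewrite wE; ring.
have [y x''E] : divides q x'.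
  apply: (prim_q c) => //; exists w; apply: (mulfI p0).
  by rewrite mulrCA -[p * x']mulrC -x'E wE; ring.
by exists y; rewrite x'E x''E; ring.
Qed.

Lemma unit_top_binomial (i j : int) c e : e \is a GRing.unit -> i < j ->
  unit_top (lconst c * lmon R i + lconst e * lmon R j).
Proof.
move=> Ue ij; exists (j : zgrp); rewrite /lconst /lmon !gmonM !mulr1 !mul1g.
  rewrite gcoefD !gcoef_mon eqxx (_ : ((i : zgrp) == j) = false) ?add0r //.
  by apply: negbTE; apply: contraTneq ij => ->; rewrite ltxx.
move=> k; rewrite gsuppE gcoefD !gcoef_mon.
case: ((i : zgrp) =P k) => [<- _|_]; first exact: ltW.
by case: ((j : zgrp) =P k) => [<- //|_]; rewrite addr0 eqxx.
Qed.

Lemma unit_top_neq0 p : unit_top p -> p != 0.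
Proof.
case=> n Un _; apply: contraTneq Un => ->.
by rewrite [gcoef _ _]mcoeff0 unitr0.
Qed.

End Laurent.

(** * Minors of explicit matrices *)

Definition rowsmx (L : pzRingType) m n (s : seq (seq L)) : 'M[L]_(m, n) :=
  \matrix_(i, j) (nth [::] s i)`_j.

Section Minors.

Variable L : comNzRingType.

Definition divides_minors m n (M : 'M[L]_(m, n)) (d : L) : Prop :=
  forall I : 'I_n -> 'I_m, (forall u v : 'I_n, (u < v)%N -> (I u < I v)%N) ->
    divides d (\det (rowsub I M)).

(** Multiplying A v = c y by the adjugate gives det A times v as a multiple of c; the invertible
    coordinate of v isolates det A. *)
Lemma divides_det_ker n (A : 'M[L]_n) (v y : 'cV_n) c (e : L) i :
  A *m v = c *: y -> e * v i 0 = 1 -> divides c (\det A).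
Proof.
move=> Av ev; exists (e * (\adj A *m y) i 0).
have := congr1 (mulmx (\adj A)) Av; rewrite mulmxA mul_adj_mx mul_scalar_mx.
rewrite -scalemxAr => /matrixP/(_ i 0); rewrite [LHS]mxE [RHS]mxE => E.
by rewrite -mulrA [_ * c]mulrC -E mulrCA ev mulr1.
Qed.

(** The gcd ranges over increasing row choices, while a triangular form lists rows in pivot order;
    [f] sends each position to its rank after sorting. *)
Lemma sort_row_choice m n (I : 'I_n -> 'I_m) : injective I ->
  exists I' : 'I_n -> 'I_m, exists f : 'I_n -> 'I_n,
    (forall u v : 'I_n, (u < v)%N -> (I' u < I' v)%N) /\ I =1 I' \o f.
Proof.
move=> injI; pose s := sort (relpre val leq) (map I (enum 'I_n)).
have sz_s : size s = n by rewrite size_sort size_map size_enum_ord.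
have uniq_s : uniq s by rewrite sort_uniq map_inj_uniq ?enum_uniq.
have sorted_s : sorted ltn (map val s).
  rewrite ltn_sorted_uniq_leq map_inj_uniq ?uniq_s; last exact: val_inj.
  by rewrite /= sorted_map; apply: sort_sorted => x y; apply: leq_total.
pose I' (u : 'I_n) := nth (I u) s u.
have I'E (u : 'I_n) x : I' u = nth x s u by apply: set_nth_default; rewrite sz_s.
have /fin_all_exists[f If] (u : 'I_n) : exists w : 'I_n, I u = I' w.
  have Iu : I u \in s by rewrite mem_sort map_f ?mem_enum.
  have lt_w : (index (I u) s < n)%N by rewrite -sz_s index_mem.
  by exists (Ordinal lt_w); rewrite (I'E _ (I u)) nth_index.
exists I', f; split=> // u v uv.
have := (sorted_ltn_nth ltn_trans 0%N sorted_s) u v.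
rewrite !inE size_map sz_s !ltn_ord => /(_ isT isT uv).
by rewrite !(nth_map (I v)) ?sz_s // (I'E u (I v)).
Qed.

Lemma divides_minors_inj m n (M : 'M[L]_(m, n)) d (I : 'I_n -> 'I_m) :
  divides_minors M d -> injective I -> divides d (\det (rowsub I M)).
Proof.
move=> dM /sort_row_choice[I' [f [incI' IE]]].
have -> : rowsub I M = rowsub f 1%:M *m rowsub I' M.
  by rewrite -rowsubE; apply/matrixP => u v; rewrite !mxE IE.
by rewrite det_mulmx; apply/divides_mull/dM.
Qed.

Definition dot (r c : seq L) : L := foldr +%R 0 [seq p.1 * p.2 | p <- zip r c].

Lemma dotE n (r c : seq L) : size r = n -> size c = n ->
  \sum_(k < n) r`_k * c`_k = dot r c.
Proof.
elim: n r c => [|n IHn] [|x r] [|y c] //=; first by rewrite big_ord0.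
by move=> [szr] [szc]; rewrite big_ord_recl /= (IHn r c).
Qed.

(** Triangularity gives minor times det Q = product of [dg], where Q has columns [cols]; hence a
    divisor of the minor divides that product, whatever det Q is. *)
Lemma divides_minors_trig m n (rows cols : seq (seq L)) (s : seq nat) (dg : seq L) d :
  divides_minors (rowsmx m n rows) d ->
  uniq s -> all (fun i => i < m)%N s -> size s = n -> size dg = n ->
  all (fun r => size r == n) [seq nth [::] rows i | i <- s] ->
  all (fun c => size c == n) cols -> size cols = n ->
  (forall i, (i < n)%N -> forall j, (j < n)%N -> (i <= j)%N ->
     dot (nth [::] rows (nth 0%N s i)) (nth [::] cols j) = if i == j then dg`_i else 0) ->
  divides d (\prod_(x <- dg) x).
Proof.
move=> dM uniq_s lt_s sz_s sz_dg sz_r sz_c sz_cols dotE0.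
have lt_su (u : 'I_n) : (nth 0%N s u < m)%N.
  by move/allP: lt_s; apply; rewrite mem_nth ?sz_s.
pose I u := Ordinal (lt_su u).
have injI : injective I.
  move=> u v /(congr1 val)/eqP /=; rewrite nth_uniq ?sz_s //.
  by move/eqP/val_inj.
have [q qE] := divides_minors_inj dM injI.
pose Q : 'M[L]_n := \matrix_(k, j) (nth [::] cols j)`_k.
have TE (i j : 'I_n) : (rowsub I (rowsmx m n rows) *m Q) i j =
    dot (nth [::] rows (nth 0%N s i)) (nth [::] cols j).
  rewrite -(@dotE n).
  - by rewrite !mxE; apply: eq_bigr => k _; rewrite !mxE.
  - apply/eqP; move/allP: sz_r; apply; apply/mapP.
    by exists (nth 0%N s i); rewrite // mem_nth ?sz_s.
  - by apply/eqP; move/allP: sz_c; apply; rewrite mem_nth ?sz_cols.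
exists (\det Q * q); rewrite -mulrA -qE mulrC -det_mulmx det_trig.
  rewrite (big_nth 0) sz_dg big_mkord; apply: eq_bigr => i _.
  by rewrite TE dotE0 ?eqxx.
apply/is_trig_mxP => i j ij; rewrite TE dotE0 ?(ltnW ij) //.
by rewrite (ltn_eqF ij).
Qed.

(** One vector [v] serves all minors, because choosing rows of the matrix only chooses entries of
    [y]. *)
Lemma divides_minors_ker m n (rows : seq (seq L)) (v y : seq L) c e k :
  all (fun r => size r == n) rows -> size rows = m -> size v = n -> (k < n)%N ->
  (forall i, (i < m)%N -> dot (nth [::] rows i) v = c * y`_i) -> e * v`_k = 1 ->
  divides_minors (rowsmx m n rows) c.
Proof.
move=> sz_r sz_rows sz_v kn rowsv ev I _.
apply: (@divides_det_ker _ _ (\col_i v`_i) (\col_i y`_(I i)) c e (Ordinal kn)).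
  apply/matrixP => i j; rewrite !mxE -rowsv // -(@dotE n) //.
    by apply: eq_bigr => l _; rewrite !mxE.
  by apply/eqP; move/allP: sz_r; apply; rewrite mem_nth ?sz_rows.
by rewrite mxE.
Qed.

End Minors.

(** * The Alexander matrix *)

Section FoxMatrix.

Variables (P : presentation) (R : idomainType) (N : nat).
Variables (alpha : {multiplicative presgroup P -> zgrp}).
Variables (rho : {multiplicative presgroup P -> GL N R}).

Notation F := (freegroup 'I_(ngens P)).
Notation W := (Phi_word alpha rho).

Implicit Types (g h : F) (k : 'I_(ngens P)).

Definition dPhi k g : 'M[laurent R]_N := Phi alpha rho (fox k (gmon 1 g)).

Lemma dPhiM k g h : dPhi k (g * h)%g = dPhi k g + W g *m dPhi k h.
Proof. by rewrite /dPhi foxM (raddfD (Phi alpha rho)) /= PhiM Phi_mon mulr1z. Qed.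

Lemma dPhi_gen k i : dPhi k (fgen i) = (k == i :> nat)%:R%:M.
Proof.
rewrite /dPhi fox_gen -val_eqE /= [in LHS]eq_sym; case: eqP => _; first exact: Phi1.
by rewrite [LHS](raddf0 (Phi alpha rho)) raddf0.
Qed.

Lemma Phi_word1 : W 1%g = 1%:M.
Proof. by rewrite -(Phi1 alpha rho) -gmon1 Phi_mon mulr1z. Qed.

Lemma Phi_word_ncl g : ncl g -> W g = 1%:M.
Proof.
move=> ncl_g; rewrite -Phi_word1 /Phi_word; suff -> : pres_proj g = pres_proj 1%g by [].
by apply/pres_projP; rewrite invg1 mulg1.
Qed.

(** The product rule is applied to g = (g / h) h; a relator u v^-1 thus contributes the difference
    of the derivatives of the two sides of its relation, without inverse letters. *)
Lemma dPhiF k g h : W (g / h)%g = 1%:M -> dPhi k (g / h)%g = dPhi k g - dPhi k h.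
Proof.
by move=> Wgh; have := dPhiM k (g / h)%g h; rewrite divgK Wgh mul1mx => ->; rewrite addrK.
Qed.

Lemma alexander_mxE j u v : alexander_mx alpha rho j u v =
  dPhi (lift j (tagnat.sig1 v)) (nth 1%g (relators P) (tagnat.sig1 u))
    (tagnat.sig2 u) (tagnat.sig2 v).
Proof. by rewrite mxE. Qed.

End FoxMatrix.

Lemma tagnat_const n N (u : 'I_(\sum_(i < n) N)%N) :
  u = (tagnat.sig1 u * N + tagnat.sig2 u)%N :> nat.
Proof.
rewrite [LHS]tagnat.rect; congr addn.
rewrite -(big_ord_widen n (fun=> N)) ?sum_nat_const ?card_ord ?muln1 //; exact: ltnW.
Qed.

Section FoxTable.

Variables (L : comNzRingType) (t a b z : L).

Definition sigma1_mx : 'M[L]_3 := rowsmx 3 3 [:: [:: 0; z; 0]; [:: t * z; 0; 0]; [:: 0; 0; z]].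
Definition sigma2_mx : 'M[L]_3 := rowsmx 3 3 [:: [:: z; 0; 0]; [:: 0; 0; z]; [:: 0; t * z; 0]].
Definition tau1_mx : 'M[L]_3 := rowsmx 3 3 [:: [:: 0; b; 0]; [:: a; 0; 0]; [:: 0; 0; 1]].
Definition tau2_mx : 'M[L]_3 := rowsmx 3 3 [:: [:: 1; 0; 0]; [:: 0; 0; b]; [:: 0; a; 0]].

Notation S1 := sigma1_mx.
Notation S2 := sigma2_mx.
Notation T1 := tau1_mx.
Notation T2 := tau2_mx.

(* [fox_blocks] lists the images of the Fox derivatives, one line per relator  *)
(* of [welded_relators3], one column per generator; [b] stands for [a^-1].     *)
Definition fox_blocks : seq (seq 'M[L]_3) :=
  [:: [:: 0; 0; 1%:M + T1; 0];
      [:: 0; 0; 0; 1%:M + T2];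
      [:: 1%:M + S1 *m S2 - S2; S1 - (1%:M + S2 *m S1); 0; 0];
      [:: 0; 0; 1%:M + T1 *m T2 - T2; T1 - (1%:M + T2 *m T1)];
      [:: 1%:M; - (T2 *m T1); S1 *m T2 - T2; S1 - 1%:M];
      [:: T1 *m S2 - S2; T1 - 1%:M; 1%:M; - (S2 *m S1)]].

(* The derivatives with respect to the [k]-th generator, expanded by the      *)
(* product rule only.                                                         *)
Definition fox_words (k : nat) : seq 'M[L]_3 :=
  let e (n : nat) : 'M[L]_3 := (k == n)%:R%:M in
  [:: e 2%N + T1 *m e 2%N;
      e 3%N + T2 *m e 3%N;
      (e 0%N + S1 *m e 1%N + (S1 *m S2) *m e 0%N) - (e 1%N + S2 *m e 0%N + (S2 *m S1) *m e 1%N);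
      (e 2%N + T1 *m e 3%N + (T1 *m T2) *m e 2%N) - (e 3%N + T2 *m e 2%N + (T2 *m T1) *m e 3%N);
      (e 0%N + S1 *m e 3%N + (S1 *m T2) *m e 2%N) - (e 3%N + T2 *m e 2%N + (T2 *m T1) *m e 1%N);
      (e 2%N + T1 *m e 1%N + (T1 *m S2) *m e 0%N) - (e 1%N + S2 *m e 0%N + (S2 *m S1) *m e 3%N)].

Lemma fox_wordsE k i : (i < 6)%N -> (k < 4)%N ->
  nth 0 (fox_words k) i = nth 0 (nth [::] fox_blocks i) k.
Proof.
case: i => [|[|[|[|[|[|//]]]]]] _; case: k => [|[|[|[|//]]]] _ /=;
  by rewrite ?(mulmx0, mulmx1, raddf0, addr0, add0r, subr0, sub0r, oppr0).
Qed.

Definition fox_table : seq (seq L) :=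
  [:: [:: 0; 0; 0; 0; 0; 0; 1; b; 0; 0; 0; 0];
       [:: 0; 0; 0; 0; 0; 0; a; 1; 0; 0; 0; 0];
       [:: 0; 0; 0; 0; 0; 0; 0; 0; 2%:R; 0; 0; 0];
       [:: 0; 0; 0; 0; 0; 0; 0; 0; 0; 2%:R; 0; 0];
       [:: 0; 0; 0; 0; 0; 0; 0; 0; 0; 0; 1; b];
       [:: 0; 0; 0; 0; 0; 0; 0; 0; 0; 0; a; 1];
       [:: 1 - z; 0; z ^+ 2; - 1; z - z ^+ 2; 0; 0; 0; 0; 0; 0; 0];
       [:: t * z ^+ 2; 1; - z; t * z; - 1; - z ^+ 2; 0; 0; 0; 0; 0; 0];
       [:: 0; t * z ^+ 2 - t * z; 1; - t ^+ 2 * z ^+ 2; 0; z - 1; 0; 0; 0; 0; 0; 0];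
       [:: 0; 0; 0; 0; 0; 0; 0; 0; b ^+ 2; - 1; 0; 0];
       [:: 0; 0; 0; 0; 0; 0; a; 1; - b; a; - 1; - b];
       [:: 0; 0; 0; 0; 0; 0; 0; 0; 1; - a ^+ 2; 0; 0];
       [:: 1; 0; 0; 0; - b; 0; - 1; 0; b * z; - 1; z; 0];
       [:: 0; 1; 0; 0; 0; - b; t * z; 0; - b; t * z; - 1; 0];
       [:: 0; 0; 1; - a ^+ 2; 0; 0; 0; a * z - a; 0; 0; 0; z - 1];
       [:: - z; 0; b * z; - 1; b; 0; 1; 0; 0; 0; - z ^+ 2; 0];
       [:: a * z; 0; - z; a; - 1; 0; 0; 1; 0; 0; 0; - z ^+ 2];
       [:: 0; 0; 0; 0; 0; 0; 0; 0; 1; - t ^+ 2 * z ^+ 2; 0; 0]].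

Hypothesis ab : a * b = 1.

Lemma fox_tableE (i k r c : nat) : (i < 6)%N -> (k < 4)%N -> (r < 3)%N -> (c < 3)%N ->
  nth 0 (nth [::] fox_blocks i) k (inord r) (inord c) =
  (nth [::] fox_table (i * 3 + r))`_(k * 3 + c).
Proof.
have o0 : inord 0 = ord0 :> 'I_3 by apply: val_inj; rewrite /= inordK.
have o1 : inord 1 = lift ord0 ord0 :> 'I_3 by apply: val_inj; rewrite /= inordK.
have o2 : inord 2 = lift ord0 (lift ord0 ord0) :> 'I_3 by apply: val_inj; rewrite /= inordK.
case: i => [|[|[|[|[|[|//]]]]]] _; case: k => [|[|[|[|//]]]] _;
  case: r => [|[|[|//]]] _; case: c => [|[|[|//]]] _; rewrite ?(o0, o1, o2) /=;
  rewrite !mxE ?big_ord_recl ?big_ord0 ?mxE /=; first [done | by ring: ab].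
Qed.

Definition table_minus (j : nat) : seq (seq L) :=
  [seq take (j * 3) r ++ drop (j * 3 + 3) r | r <- fox_table].

Lemma table_minusE j i r k c :
  (j < 4)%N -> (i < 6)%N -> (r < 3)%N -> (c < 3)%N ->
  (nth [::] (table_minus j) (i * 3 + r))`_(k * 3 + c) =
  (nth [::] fox_table (i * 3 + r))`_(bump j k * 3 + c).
Proof.
move=> j4 i6 r3 c3; have ir : (i * 3 + r < 18)%N by lia.
rewrite /table_minus (nth_map [::]) //; set row := nth [::] _ _.
have sz_row : size row = 12.
  have /allP/(_ row) : all (fun s => size s == 12) fox_table by [].
  by rewrite mem_nth => [/(_ isT)/eqP//|].
rewrite nth_cat size_take sz_row (_ : (j * 3 < 12)%N = true); last by lia.
rewrite /bump; case: ltnP => [lt|ge].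
  by rewrite nth_take //; congr (row`_ _); case: (leqP j k) => ?; lia.
by rewrite nth_drop; congr (row`_ _); case: (leqP j k) => ?; lia.
Qed.

End FoxTable.

(** * Determinants of 1 minus a generator *)

Ltac expand_det3 :=
  rewrite (expand_det_row _ ord0) !big_ord_recl big_ord0 /cofactor !(expand_det_row _ ord0);
  rewrite !big_ord_recl !big_ord0 /cofactor !det_mx11 !mxE /bump /=.

Section Determinants.

Variables (L : comNzRingType) (t a b z : L).

Lemma det_1sigma1 : \det (1%:M - sigma1_mx t z) = (1 - z) * (1 - t * z ^+ 2).
Proof. by expand_det3; ring. Qed.

Lemma det_1sigma2 : \det (1%:M - sigma2_mx t z) = (1 - z) * (1 - t * z ^+ 2).
Proof. by expand_det3; ring. Qed.

Hypothesis ab : a * b = 1.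

Lemma det_1tau1 : \det (1%:M - tau1_mx a b) = 0.
Proof. by expand_det3; ring: ab. Qed.

Lemma det_1tau2 : \det (1%:M - tau2_mx a b) = 0.
Proof. by expand_det3; ring: ab. Qed.

End Determinants.

(** * The Alexander matrix of the welded braid group on three strands *)

Lemma enum_ord2 : enum 'I_2 = [:: ord0; lift ord0 ord0].
Proof. by rewrite enum_ordSl enum_ordSl enum_ord0. Qed.

Local Notation s1 := (wsigma (n := 3) ord0).
Local Notation s2 := (wsigma (n := 3) (lift ord0 ord0)).
Local Notation t1 := (wtau (n := 3) ord0).
Local Notation t2 := (wtau (n := 3) (lift ord0 ord0)).

(** No two of the two indices are at distance 2, so the commutation families are empty, and each
    braid-type family has a single member. *)
Lemma welded_relators3 : welded_relators 3 =
  [:: t1 * t1; t2 * t2;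
      (s1 * s2 * s1) / (s2 * s1 * s2); (t1 * t2 * t1) / (t2 * t1 * t2);
      (s1 * t2 * t1) / (t2 * t1 * s2); (t1 * s2 * s1) / (s2 * s1 * t2)]%g.
Proof. by rewrite /welded_relators /far /succ_of /= enum_ord2. Qed.

Lemma size_relators3 : size (relators (welded_presentation 3)) = 6.
Proof. by rewrite /= welded_relators3. Qed.

Definition zvar : laurent ZTA := lmon ZTA zgen.
Definition tconst : laurent ZTA := lconst tvar.
Definition aconst : laurent ZTA := lconst avar.
Definition aconstV : laurent ZTA := lconst avar^-1.

Lemma aconst_mulV : aconst * aconstV = 1.
Proof. by rewrite /aconst /aconstV -rmorphM divrr ?avar_unit // rmorph1. Qed.

Local Notation W3 := (Phi_word (welded_deg 3) (wTYM 3)).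

Lemma Phi_word_sigma (i : 'I_2) : W3 (wsigma (n := 3) i) =
  zvar *: map_mx (@lconst ZTA) (blk (n := 3) i 1 tvar).
Proof.
by rewrite /Phi_word (_ : pres_proj _ = sigma (n := 3) i) // welded_deg_sigma wTYM_sigma.
Qed.

Lemma Phi_word_tau (i : 'I_2) : W3 (wtau (n := 3) i) =
  map_mx (@lconst ZTA) (blk (n := 3) i avar^-1 avar).
Proof.
by rewrite /Phi_word (_ : pres_proj _ = tau (n := 3) i) // welded_deg_tau wTYM_tau lmon1 scale1r.
Qed.

Ltac blk_entries :=
  apply/matrixP => -[[|[|[|//]]] ?] [[|[|[|//]]] ?]; rewrite !mxE /=
    ?(mulr1n, mulr0n, rmorph0, rmorph1, mulr0, mulr1) //; by rewrite mulrC.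

Lemma Phi_word_sigma1 : W3 s1 = sigma1_mx tconst zvar.
Proof. by rewrite Phi_word_sigma; blk_entries. Qed.

Lemma Phi_word_sigma2 : W3 s2 = sigma2_mx tconst zvar.
Proof. by rewrite Phi_word_sigma; blk_entries. Qed.

Lemma Phi_word_tau1 : W3 t1 = tau1_mx aconst aconstV.
Proof. by rewrite Phi_word_tau; blk_entries. Qed.

Lemma Phi_word_tau2 : W3 t2 = tau2_mx aconst aconstV.
Proof. by rewrite Phi_word_tau; blk_entries. Qed.

Lemma Phi_word_relator r : r \in welded_relators 3 -> W3 r = 1%:M.
Proof. by move=> r_rel; apply: Phi_word_ncl; rewrite -[r]conjg1; apply: ncl_rel. Qed.

Lemma dPhi_blocks (k : 'I_4) i : (i < 6)%N ->
  dPhi (welded_deg 3) (wTYM 3) k (nth 1%g (welded_relators 3) i) =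
  nth 0 (nth [::] (fox_blocks tconst aconst aconstV zvar) i) k.
Proof.
move=> i6; have := Phi_word_relator (mem_nth 1%g (_ : (i < size (welded_relators 3))%N)).
rewrite welded_relators3 => /(_ i6) W1.
pose dk := dPhi (welded_deg 3) (wTYM 3) k.
have d1 : dk s1 = (k == 0 :> nat)%:R%:M by exact: dPhi_gen.
have d2 : dk s2 = (k == 1 :> nat)%:R%:M by exact: dPhi_gen.
have d3 : dk t1 = (k == 2 :> nat)%:R%:M by exact: dPhi_gen.
have d4 : dk t2 = (k == 3 :> nat)%:R%:M by exact: dPhi_gen.
rewrite -fox_wordsE // {}/dk in d1 d2 d3 d4 *.
case: i i6 W1 => [|[|[|[|[|[|//]]]]]] _ /= W1;
  by rewrite ?(dPhiF _ W1) ?dPhiM ?Phi_wordM {W1} ?(d1, d2, d3, d4)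
     ?(Phi_word_sigma1, Phi_word_sigma2, Phi_word_tau1, Phi_word_tau2).
Qed.

(** The dimensions of [alexander_mx] are sums that must be proved equal to 18 and 9; entries are
    therefore matched by their numerical position. *)
Lemma divides_minors_cast (L : comNzRingType) m n m' n' (A : 'M[L]_(m, n)) (rows : seq (seq L)) :
  m = m' -> n = n' -> (forall u v, A u v = (nth [::] rows u)`_v) ->
  forall d, divides_minors A d <-> divides_minors (rowsmx m' n' rows) d.
Proof.
move=> <- <- AE d; suff -> : A = rowsmx m n rows by [].
by apply/matrixP => u v; rewrite mxE.
Qed.

Lemma alexander_mx3E (j : 'I_4) u v :
  alexander_mx (welded_deg 3) (wTYM 3) j u v =
  (nth [::] (table_minus tconst aconst aconstV zvar j) u)`_v.
Proof.
rewrite alexander_mxE.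
have u6 : (tagnat.sig1 u < 6)%N by rewrite -[X in (_ < X)%N]size_relators3.
rewrite (tagnat_const u) (tagnat_const v) table_minusE //.
move: (tagnat.sig1 u) (tagnat.sig2 u) u6 => i r u6.
move: (tagnat.sig1 v) (tagnat.sig2 v) => k c.
transitivity (nth 0 (nth [::] (fox_blocks tconst aconst aconstV zvar) i) (lift j k) r c).
  exact: (congr1 (fun A : 'M_3 => A r c) (dPhi_blocks (lift j k) u6)).
by rewrite -[r in LHS]inord_val -[c in LHS]inord_val fox_tableE ?aconst_mulV.
Qed.

(** * Minors of the Alexander matrix *)

Section ExplicitMinors.

Variables (L : comNzRingType) (t ti a b z zi : L).
Hypotheses (tti : t * ti = 1) (ab : a * b = 1) (zzi : z * zi = 1).

Notation table := (table_minus t a b z).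

Ltac ker_entries := do 18?[case=> [_|]]; rewrite // /dot /=; ring: ab.

Ltac trig_entries :=
  case=> [|[|[|[|[|[|[|[|[|//]]]]]]]]] _;
    case=> [|[|[|[|[|[|[|[|[|//]]]]]]]]] //= _ _; rewrite /dot /=; ring: ab.

(* In the next four lemmas, the first list is a vector whose image under the  *)
(* matrix is the given factor times the second list.                          *)
Lemma drop0_minors_tz2 : divides_minors (rowsmx 18 9 (table 0)) (1 - t * z ^+ 2).
Proof.
(* The vector u = (z, 1, 0) is fixed by [sigma1_mx] modulo 1 - t z^2. Up to a multiple of that
   factor, the blocks of the list are (1 - x) u for x the matrices of sigma_2, tau_1, tau_2, as in
   Fox's formula. *)
apply: (@divides_minors_ker _ _ _ _
  [:: z - z ^+ 2; 1; t * a * z ^+ 2 - a - t * z; z - b; 1 - a * z; 0; 0; 1; - a]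
  [:: 0; 0; 0; 0; 0; 0; 0; a * z ^+ 2 - 1; a + t * z - a * z - t * z ^+ 2; 0; 0; 0; 0;
      0; 0; 0; 0; 0]
  _ 1 1) => //=; last by ring: zzi.
by ker_entries.
Qed.

Lemma drop0_minors_z : divides_minors (rowsmx 18 9 (table 0)) (1 - z).
Proof.
(* Same construction from u = (0, 0, 1), fixed by [sigma1_mx] modulo 1 - z. *)
apply: (@divides_minors_ker _ _ _ _
  [:: b * z ^+ 2 - b * z; - z; 1; 0; 0; 0; 0; - b; 1]
  [:: 0; 0; 0; 0; 0; 0; b * z - z ^+ 2; z - t * b * z ^+ 2; t ^+ 2 * b * z ^+ 3 - 1;
      0; 0; 0; 0; 0; a * z - 1; 0; 0; 0]
  _ 1 2) => //=; last by ring: zzi.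
by ker_entries.
Qed.

Lemma drop1_minors_tz2 : divides_minors (rowsmx 18 9 (table 1)) (1 - t * z ^+ 2).
Proof.
(* Here u = (0, z, 1) is fixed by [sigma2_mx] modulo 1 - t z^2, and the blocks belong to sigma_1,
   tau_1, tau_2. *)
apply: (@divides_minors_ker _ _ _ _
  [:: - z ^+ 2; z + t * z ^+ 4 - z ^+ 2; 1 - z; - b * z; z; 0; 0; z - b; 1 - a * z]
  [:: 0; 0; 0; 0; 0; 0; 0; 0; 1 + t * z ^+ 3 - z - t * z ^+ 4; 0; 0; 0; 0; b - z ^+ 2;
      0; 0; 0; 0]
  _ zi 4) => //=; last by ring: zzi.
by ker_entries.
Qed.

Lemma drop1_minors_z : divides_minors (rowsmx 18 9 (table 1)) (1 - z).
Proof.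
(* Here u = (1, 0, 0) is fixed by [sigma2_mx] modulo 1 - z; the blocks are (x - 1) u, with the
   opposite sign. *)
apply: (@divides_minors_ker _ _ _ _
  [:: - 1; t * z ^+ 2; 0; - 1; a; 0; 0; 0; 0]
  [:: 0; 0; 0; 0; 0; 0; - 1; 0; - t ^+ 2 * z ^+ 3; 0; 0; 0; 0; - t * z; - a ^+ 2; - 1;
      a; 0]
  _ (- 1) 0) => //=; last by ring: zzi.
by ker_entries.
Qed.

(* In the next four lemmas, [cols] are the columns of a matrix found by       *)
(* column reduction of the rows [s] of the table, taken in pivot order; the   *)
(* product is lower triangular with diagonal [dg].                            *)
Lemma drop0_minor_az2 d : divides_minors (rowsmx 18 9 (table 0)) d ->
  divides d ((1 - z) * (1 - t * z ^+ 2) * ((1 - a * z ^+ 2) * (a ^+ 2 - t ^+ 2 * z ^+ 2))).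
Proof.
pose s := [:: 0; 9; 17; 6; 7; 12; 15; 13; 16]%N.
pose cols :=
  [:: [:: 0; 0; 0; 0; 1; 0; 0; 0; 0];
      [:: 0; 0; 0; 0; 0; 1; 0; 0; 0];
      [:: 0; 0; 0; 0; 0; a ^+ 2; 1; 0; 0];
      [:: 1; 0; 0; 0; 0; 0; 0; 0; 0];
      [:: 0; 0; 1; 0; 0; 0; 0; 0; 0];
      [:: 0; 0; 0; 1; - a; 0; 0; 0; 0];
      [:: 0; 0; 0; z; - a * z; 0; 0; 1; 0];
      [:: z ^+ 3 - z ^+ 4; z ^+ 2; t * z ^+ 2 - 1 - t * z ^+ 3; z ^+ 3 - b * z ^+ 2;
          z ^+ 2 - a * z ^+ 3; 0; 0; z ^+ 2; 0];
      [:: 0; 0; 0; 0; 0; 0; 0; 0; 1]].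
(* The four-term entry equals b (1 - t z^2) (1 - a z^2); besides it, a^2 - t^2 z^2 and z (1 - z),
   only units occur. *)
pose dg := [:: b; b ^+ 2; a ^+ 2 - t ^+ 2 * z ^+ 2; - 1; - z ^+ 2; - 1; z - z ^+ 2;
              b + t * z ^+ 4 - z ^+ 2 - t * b * z ^+ 2; - z ^+ 2].
move=> dM; have dE : divides d (\prod_(x <- dg) x).
  apply: (divides_minors_trig (cols := cols) (s := s) dM) => //.
  by rewrite /dg /cols /s; trig_entries.
rewrite [X in divides d X](_ : _ = (a ^+ 4 * zi ^+ 5) * \prod_(x <- dg) x);
  first exact: divides_mull.
by rewrite !big_cons big_nil; ring: ab zzi tti.
Qed.

Lemma drop0_minor_tz6 d : divides_minors (rowsmx 18 9 (table 0)) d ->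
  divides d ((1 - z) * (1 - t * z ^+ 2) * (2%:R * (1 - t ^+ 2 * z ^+ 6))).
Proof.
pose s := [:: 2; 9; 0; 8; 6; 7; 13; 15; 4]%N.
pose cols :=
  [:: [:: 0; 0; 0; 0; 0; 1; 0; 0; 0];
      [:: 0; 0; 0; 0; 0; 0; 1; 0; 0];
      [:: 0; 0; 0; 1; 0; 0; 0; 0; 0];
      [:: 1; 0; 0; 0; 0; 0; 0; 0; 0];
      [:: 0; 1; 0; 0; 0; 0; 0; 0; 0];
      [:: z ^+ 2 - z; - 1; t ^+ 2 * z ^+ 3; 0; 0; 0; 0; 0; 0];
      [:: 0; 0; 0; 0; 0; 0; 0; 1; 0];
      [:: 0; 0; 0; - b; 1; 0; 0; - t * b * z; 0];
      [:: 0; 0; 0; 0; 0; 0; 0; 0; 1]].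
(* The four-term entry equals (1 - t z^2) (1 + t z^3); with - b (1 - t z^3) it yields the factor 1 -
   t^2 z^6. *)
pose dg := [:: 2%:R; - 1; 1; - t ^+ 2 * z ^+ 2; z - z ^+ 2;
               1 + t * z ^+ 3 - t * z ^+ 2 - t ^+ 2 * z ^+ 5; - 1; t * b * z ^+ 3 - b;
               b].
move=> dM; have dE : divides d (\prod_(x <- dg) x).
  apply: (divides_minors_trig (cols := cols) (s := s) dM) => //.
  by rewrite /dg /cols /s; trig_entries.
rewrite [X in divides d X](_ : _ = (ti ^+ 2 * a ^+ 2 * zi ^+ 3) * \prod_(x <- dg) x);
  first exact: divides_mull.
by rewrite !big_cons big_nil; ring: ab zzi tti.
Qed.

Lemma drop1_minor_az2 d : divides_minors (rowsmx 18 9 (table 1)) d ->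
  divides d ((1 - z) * (1 - t * z ^+ 2) * ((1 - a * z ^+ 2) * (a ^+ 2 - t ^+ 2 * z ^+ 2))).
Proof.
pose s := [:: 0; 4; 17; 10; 13; 12; 15; 6; 7]%N.
pose cols :=
  [:: [:: 0; 0; 0; 1; 0; 0; 0; 0; 0];
      [:: 0; 0; 0; 0; 0; 0; 0; 0; 1];
      [:: 0; 0; 0; 0; 0; 0; 1; 0; 0];
      [:: 0; 0; 0; 0; 0; t ^+ 2 * z ^+ 2; 1; 0; 0];
      [:: 0; 1; 0; 0; 0; 0; 0; 0; 0];
      [:: 1; 0; 0; 0; 0; 0; 0; 0; 0];
      [:: 0; 0; 1; 0; 0; 0; 0; 0; 0];
      [:: - z; 1; 0; 0; 0; 0; 0; 1; - a];
      [:: - z ^+ 2; z + t * b * z ^+ 2 - b; 1 - z; - b * z; z; 0; 0; z - b; 1 - a * z]].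
pose dg := [:: 1; b; - t ^+ 2 * z ^+ 2; a - t ^+ 2 * b * z ^+ 2; 1; 1; b * z;
               z ^+ 2 - z; z ^+ 2 + t * b * z ^+ 2 - b - t * z ^+ 4].
move=> dM; have dE : divides d (\prod_(x <- dg) x).
  apply: (divides_minors_trig (cols := cols) (s := s) dM) => //.
  by rewrite /dg /cols /s; trig_entries.
rewrite [X in divides d X](_ : _ = (- (ti ^+ 2 * a ^+ 4 * zi ^+ 4)) * \prod_(x <- dg) x);
  first exact: divides_mull.
by rewrite !big_cons big_nil; ring: ab zzi tti.
Qed.

Lemma drop1_minor_tz6 d : divides_minors (rowsmx 18 9 (table 1)) d ->
  divides d ((1 - z) * (1 - t * z ^+ 2) * (2%:R * (1 - t ^+ 2 * z ^+ 6))).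
Proof.
pose s := [:: 3; 17; 8; 6; 7; 13; 15; 1; 16]%N.
pose cols :=
  [:: [:: 0; 0; 0; 0; 0; 0; 1; 0; 0];
      [:: 0; 0; 0; 0; 0; 1; 0; 0; 0];
      [:: 0; 0; 1; 0; 0; 0; 0; 0; 0];
      [:: 1; 0; 0; 0; 0; 0; 0; 0; 0];
      [:: - t * z ^+ 3; 1; t * z - t * z ^+ 2; 0; 0; 0; 0; 0; 0];
      [:: 0; 0; 0; 1; 0; 0; 0; 0; 0];
      [:: 0; 0; 0; 1; 0; 0; 0; t * z; 0];
      [:: 0; 0; 0; 0; 1; 0; 0; 0; 0];
      [:: 0; 0; 0; 0; 0; 0; 0; 0; 1]].
pose dg := [:: 2%:R; 1; 1; 1 - z; 1 + t * z ^+ 3 - t * z ^+ 2 - t ^+ 2 * z ^+ 5;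
               t * z; 1 - t * z ^+ 3; 1; - z ^+ 2].
move=> dM; have dE : divides d (\prod_(x <- dg) x).
  apply: (divides_minors_trig (cols := cols) (s := s) dM) => //.
  by rewrite /dg /cols /s; trig_entries.
rewrite [X in divides d X](_ : _ = (- (ti * zi ^+ 3)) * \prod_(x <- dg) x);
  first exact: divides_mull.
by rewrite !big_cons big_nil; ring: ab zzi tti.
Qed.

End ExplicitMinors.

(** * The gcd of the minors *)

Lemma gcoef0 (R : nzRingType) (G : groupType) (k : G) : gcoef k (0 : grpring R G) = 0.
Proof. exact: mcoeff0. Qed.

Lemma gcoef_lmon (R : comNzRingType) (k h : zgrp) : gcoef k (lmon R h) = (h == k)%:R.
Proof. exact: gcoef_mon. Qed.

Lemma gcoef_lconst (R : comNzRingType) (k : zgrp) c :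
  gcoef k (lconst c : laurent R) = c *+ (k == 1%g).
Proof. by rewrite gcoef_mon eq_sym. Qed.

Lemma lmon_genX (R : comNzRingType) n : lmon R zgen ^+ n = lmon R (n%:Z : zgrp).
Proof. by elim: n => // n IHn; rewrite exprS IHn -lmonM. Qed.

Section Denominator.

Variables (R : idomainType) (t0 a0 : R).

Notation t := (lconst t0).
Notation a := (lconst a0).
Notation z := (lmon R zgen).

Definition tym_denom : laurent R := (1 - z) * (1 - t * z ^+ 2).

Hypotheses (Ut : t0 \is a GRing.unit) (Ua : a0 \is a GRing.unit).

Lemma unit_top_1z : unit_top (1 - z).
Proof.
have -> : 1 - z = lconst 1 * lmon R (0 : int) + lconst (- 1) * lmon R (1 : int).
  by rewrite rmorphN rmorph1 mul1r mulN1r.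
by apply: unit_top_binomial; rewrite ?unitrN ?unitr1.
Qed.

Lemma unit_top_1cz2 (c : R) : c \is a GRing.unit -> unit_top (1 - lconst c * z ^+ 2).
Proof.
move=> Uc.
have -> : 1 - lconst c * z ^+ 2 = lconst 1 * lmon R (0 : int) + lconst (- c) * lmon R (2 : int).
  by rewrite rmorphN rmorph1 mul1r mulNr lmon_genX.
by apply: unit_top_binomial; rewrite ?unitrN.
Qed.

Lemma unit_top_a2t2z2 : unit_top (a ^+ 2 - t ^+ 2 * z ^+ 2).
Proof.
have -> : a ^+ 2 - t ^+ 2 * z ^+ 2 =
    lconst (a0 ^+ 2) * lmon R (0 : int) + lconst (- t0 ^+ 2) * lmon R (2 : int).
  by rewrite rmorphN !rmorphXn mulNr lmon_genX mulr1.
by apply: unit_top_binomial; rewrite ?unitrN ?unitrX.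
Qed.

Lemma tym_denom_neq0 : tym_denom != 0.
Proof. exact: mulf_neq0 (unit_top_neq0 unit_top_1z) (unit_top_neq0 (unit_top_1cz2 Ut)). Qed.

Hypotheses (t_neq1 : 1 - t0 != 0) (two_neq0 : 2%:R != 0 :> R).
Hypotheses (a3t2 : a0 ^+ 3 - t0 ^+ 2 != 0) (t4a6 : t0 ^+ 4 - a0 ^+ 6 != 0).

(* Modulo [1 - z] the second factor is the constant [1 - t]. *)
Lemma tym_denom_divides m :
  divides (1 - z) m -> divides (1 - t * z ^+ 2) m -> divides tym_denom m.
Proof.
move=> [q mE] [w wE]; have [w' w'E] : divides (1 - z) w.
  apply: (unit_top_prime_to_const unit_top_1z t_neq1).
  exists (q - t * (1 + z) * w); rewrite rmorphB rmorph1.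
  by rewrite [RHS]mulrBl -mE wE; ring.
by exists w'; rewrite wE w'E /tym_denom; ring.
Qed.

(** Writing the two multiples of D as x d and y d gives 2 U x = X Y y. A nonzero constant lies in
    the ideal of 2 U and X Y, so X Y divides a constant times x, hence x itself, and cancelling X Y
    leaves D as a multiple of d. *)
Lemma divides_tym_denom d :
  divides d (tym_denom * ((1 - a * z ^+ 2) * (a ^+ 2 - t ^+ 2 * z ^+ 2))) ->
  divides d (tym_denom * (2%:R * (1 - t ^+ 2 * z ^+ 6))) ->
  divides d tym_denom.
Proof.
have top_X := unit_top_1cz2 Ua; have top_Y := unit_top_a2t2z2.
have D0 := tym_denom_neq0; move: tym_denom D0 => D D0.
set X := 1 - a * z ^+ 2 in top_X *; set Y := a ^+ 2 - _ in top_Y *.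
set U := 1 - t ^+ 2 * z ^+ 6 => -[x xE] [y yE].
have X0 := unit_top_neq0 top_X; have Y0 := unit_top_neq0 top_Y.
have d0 : d != 0.
  by apply: contra_eq_neq xE => ->; rewrite mulr0 !mulf_neq0.
have xy : 2%:R * U * x = X * Y * y.
  by apply: (mulIf d0); rewrite -[LHS]mulrA -xE -[RHS]mulrA -yE; ring.
have [w xwE] : divides (X * Y) x.
  (* The factors come from evaluating U at the roots of X and Y: a^3 U is a^3 - t^2 at z^2 = 1/a,
     and t^4 U is t^4 - a^6 at z^2 = a^2/t^2. *)
  pose c := 2%:R * (a0 ^+ 3 - t0 ^+ 2) * (t0 ^+ 4 - a0 ^+ 6).
  apply: (@prime_to_constM _ X Y X0 _ _ c).
  - exact: unit_top_prime_to_const top_X.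
  - exact: unit_top_prime_to_const top_Y.
  - by rewrite !mulf_neq0.
  pose A := 1 + a * z ^+ 2 + a ^+ 2 * z ^+ 4.
  pose B := a ^+ 4 + a ^+ 2 * t ^+ 2 * z ^+ 2 + t ^+ 4 * z ^+ 4.
  have -> : lconst c = 2%:R * (a ^+ 3 * U - t ^+ 2 * X * A) * (t ^+ 4 * U - Y * B).
    by rewrite /c !(rmorphM, rmorphB, rmorphXn, rmorph_nat) /A /B /X /Y /U; ring.
  exists ((a ^+ 3 * t ^+ 4 * U - a ^+ 3 * Y * B - t ^+ 6 * X * A) * y
          + 2%:R * t ^+ 2 * A * B * x).
  by rewrite [RHS]mulrDl -[_ * y * _]mulrA [y * _]mulrC -xy; ring.
exists w; apply: (@mulIf _ (X * Y)); first by rewrite mulf_neq0.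
by rewrite xE xwE; ring.
Qed.

Definition fox_minor_table (j : nat) : 'M[laurent R]_(18, 9) :=
  rowsmx 18 9 (table_minus t a (lconst a0^-1) z j).

Lemma tym_denom_gcd (j : nat) : (j < 2)%N ->
  divides_minors (fox_minor_table j) tym_denom /\
  (forall d, divides_minors (fox_minor_table j) d -> divides d tym_denom).
Proof.
have ab : a * lconst a0^-1 = 1 by rewrite -rmorphM divrr // rmorph1.
have tti : t * lconst t0^-1 = 1 by rewrite -rmorphM divrr // rmorph1.
have zzi : z * lmon R zgen^-1%g = 1 by rewrite -lmonM mulgV lmon1.
case: j => [|[|//]] _; split=> [I incI | d dM].
- apply: tym_denom_divides; first exact: (drop0_minors_z _ ab zzi).
  exact: (drop0_minors_tz2 _ ab zzi).
- apply: divides_tym_denom; first exact: (drop0_minor_az2 tti ab zzi dM).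
  exact: (drop0_minor_tz6 tti ab zzi dM).
- apply: tym_denom_divides; first exact: (drop1_minors_z _ ab zzi).
  exact: (drop1_minors_tz2 _ ab zzi).
- apply: divides_tym_denom; first exact: (drop1_minor_az2 tti ab zzi dM).
  exact: (drop1_minor_tz6 tti ab zzi dM).
Qed.

End Denominator.

(** * Nonvanishing of the constants in Z[t, t^-1, a, a^-1] *)

Lemma avarX n : avar ^+ n = lmon (laurent int) (n%:Z : zgrp).
Proof. exact: lmon_genX. Qed.

Lemma tvarX n : tvar ^+ n = lconst (lmon int (n%:Z : zgrp)).
Proof. by rewrite -rmorphXn lmon_genX. Qed.

Lemma tvar_neq1 : 1 - tvar != 0.
Proof.
apply/eqP => /(congr1 (gcoef 1%g))/(congr1 (gcoef 1%g)).
by rewrite !gcoef0 gcoefB gcoef1 gcoef_lconst gcoefB gcoef1 gcoef_lmon.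
Qed.

(** The outer variable is a, so t^2 is a constant and the coefficient of a^3 is 1. *)
Lemma avar3_tvar2 : avar ^+ 3 - tvar ^+ 2 != 0.
Proof.
apply/eqP => /(congr1 (gcoef (3%:Z : zgrp))) /eqP.
by rewrite gcoef0 gcoefB avarX tvarX gcoef_lmon gcoef_lconst eqxx subr0 oner_eq0.
Qed.

Lemma tvar4_avar6 : tvar ^+ 4 - avar ^+ 6 != 0.
Proof.
apply/eqP => /(congr1 (gcoef (6%:Z : zgrp))) /eqP.
by rewrite gcoef0 gcoefB avarX tvarX gcoef_lmon gcoef_lconst eqxx sub0r oppr_eq0 oner_eq0.
Qed.

Lemma ZTA_two_neq0 : 2%:R != 0 :> ZTA.
Proof.
apply/eqP => /(congr1 (gcoef 1%g))/(congr1 (gcoef 1%g)).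
by rewrite !gcoef0 !(gcoefD, gcoef1).
Qed.

(** * The twisted Alexander invariant *)

Lemma alexander_denomE (P : presentation) (R : idomainType) N
    (alpha : {multiplicative presgroup P -> zgrp})
    (rho : {multiplicative presgroup P -> GL N R}) j :
  alexander_denom alpha rho j = \det (1%:M - Phi_word alpha rho (fgen j)).
Proof.
by rewrite /alexander_denom (raddfB (Phi alpha rho)) /= Phi1 Phi_mon mulr1z.
Qed.

(** The denominator vanishes for a tau because [alpha] is trivial on it and its matrix fixes a basis
    vector. *)
Lemma alexander_denom3 (j : 'I_4) :
  alexander_denom (welded_deg 3) (wTYM 3) j = if (j < 2)%N then tym_denom tvar else 0.
Proof.
rewrite alexander_denomE.
case: j => [[|[|[|[|//]]]] j4] /=.
- rewrite (_ : fgen _ = s1); last by congr fgen; apply: val_inj.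
  by rewrite Phi_word_sigma1 det_1sigma1.
- rewrite (_ : fgen _ = s2); last by congr fgen; apply: val_inj.
  by rewrite Phi_word_sigma2 det_1sigma2.
- rewrite (_ : fgen _ = t1); last by congr fgen; apply: val_inj.
  by rewrite Phi_word_tau1 det_1tau1 ?aconst_mulV.
- rewrite (_ : fgen _ = t2); last by congr fgen; apply: val_inj.
  by rewrite Phi_word_tau2 det_1tau2 ?aconst_mulV.
Qed.

Lemma alexander_minor3_gcd (j : 'I_4) : (j < 2)%N ->
  is_gcd (@increasing (welded_presentation 3) 3)
    (alexander_minor (welded_deg 3) (wTYM 3) j) (tym_denom tvar).
Proof.
move=> j2.
have [denom_dvd dvd_denom] := tym_denom_gcd tvar_unit avar_unit tvar_neq1
  ZTA_two_neq0 avar3_tvar2 tvar4_avar6 j2.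
have m18 : (\sum_(i < size (relators (welded_presentation 3))) 3)%N = 18.
  by rewrite size_relators3 sum_nat_const card_ord.
have n9 : (\sum_(k < (ngens (welded_presentation 3)).-1) 3)%N = 9.
  by rewrite sum_nat_const card_ord.
have castE := divides_minors_cast m18 n9 (alexander_mx3E j).
by split=> [I incI | d /castE/dvd_denom //]; have /castE := denom_dvd; apply.
Qed.

Theorem mainTheorem2 :
  (exists Delta : {fraction (laurent ZTA)},
     is_twisted_alexander (welded_deg 3) (wTYM 3) Delta) /\
  (forall Delta : {fraction (laurent ZTA)},
     is_twisted_alexander (welded_deg 3) (wTYM 3) Delta ->
     doteq Delta 1%R).
Proof.
(* There are six relators for four generators, so the default value 0 for too few relators does not
   arise. *)
have twistedE Delta : is_twisted_alexander (welded_deg 3) (wTYM 3) Delta <->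
    exists (j : 'I_4) (g : laurent ZTA),
      [/\ alexander_denom (welded_deg 3) (wTYM 3) j != 0,
          is_gcd (@increasing (welded_presentation 3) 3)
            (alexander_minor (welded_deg 3) (wTYM 3) j) g &
          Delta = tofrac g / tofrac (alexander_denom (welded_deg 3) (wTYM 3) j)].
  by rewrite /is_twisted_alexander size_relators3.
have D0 : tym_denom tvar != 0 := tym_denom_neq0 tvar_unit.
split=> [|Delta].
  exists (tofrac (tym_denom tvar) / tofrac (tym_denom tvar)); apply/twistedE.
  exists ord0, (tym_denom tvar).
  by rewrite alexander_denom3; split=> //; apply: alexander_minor3_gcd.
move=> /twistedE[j [g []]]; rewrite alexander_denom3; case: ltnP => [j2 _|_ /eqP//].
have [D_dvd dvd_D] := alexander_minor3_gcd j2 => -[g_dvd dvd_g] ->.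
(* The gcd g is arbitrary, but it and D divide each other; the invariant is thus the unit u. *)
have [u Uu ->] := divides_eqv D0 (dvd_D _ g_dvd) (dvd_g _ D_dvd).
have [e [k [Ue ->]]] := laurent_unitE Uu; exists e, k; split=> //.
by rewrite rmorphM mulfK ?tofrac_eq0 // mulr1.
Qed.
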